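(* Let $I_1=\{m+ni: m\in\{1,2,3,\ldots\},\ n\in\mathbb{Z}\}$, let $\mathcal{B}\subseteq I_1$, let $D=\{z\in\mathbb{C}:|z-1/2|\le1/2\}$, and for $b\in I_1$ let $\theta_b(z)=1/(z+b)$. Let $\sigma(\mathcal B)=\inf\{s>0:\exists z\in D\text{ with }\sum_{b\in\mathcal B}|z+b|^{-2s}<\infty\}$, and for $s>\sigma(\mathcal B)$ let $L_s:C_{\mathbb R}(D)\to C_{\mathbb R}(D)$ be the bounded linear operator $$(L_sv)(z)=\sum_{b\in\mathcal B}\Big|\frac{d}{dz}\theta_b(z)\Big|^s v(\theta_b(z))=\sum_{b\in\mathcal B}\frac{v(\theta_b(z))}{|z+b|^{2s}}.$$ Then for each $s>\sigma(\mathcal B)$ there exists a strictly positive Lipschitz eigenvector $v_s$ of $L_s$, unique up to scalar multiples, with $L_sv_s=\lambda_sv_s$, where $\lambda_s>0$ and $\lambda_s=r(L_s):=\lim_{k\to\infty}\|L_s^k\|^{1/k}$. If $\bar{\mathcal B}:=\{\bar b: b\in\mathcal B\}$ equals $\mathcal B$, then $v_s(\bar z)=v_s(z)$ for all $z\in D$. If $\mathcal B$ is finite, then $v_s(x,y)$ (writing $z=x+iy$) is $C^\infty$ on $D$ and $x\mapsto v_s(x,y)$ is decreasing for $(x,y)\in D$.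
   Context: $C_{\mathbb R}(D)$ is the Banach space of real-valued continuous functions on $D$ with the sup norm. For $s>\sigma(\mathcal B)$ the series defining $L_s$ converges and $L_s$ is a bounded linear map of $C_{\mathbb R}(D)$ into itself; each $\theta_b$ maps $D$ into $D$.
   Formalization: The set B is assumed nonempty: for empty B one has σ(B)=0 and L_s=0 for every s>0, so no strictly positive eigenvector with λ_s>0 exists and the claim as worded fails. *)

(* Defs.v *)
From Stdlib Require Import Reals Lra List ClassicalEpsilon.
From Coquelicot Require Import Coquelicot.
Open Scope R_scope.

Definition I1 (b : C) : Prop :=
  exists m n : Z, (1 <= m)%Z /\ b = (IZR m, IZR n).

Definition Dset (z : C) : Prop := Cmod (Cminus z (RtoC (1/2))) <= 1/2.

Definition theta (b z : C) : C := Cinv (Cplus z b).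

(* Unconditional (= absolute, in R) summation of a real family over a set. *)
Definition sum_list (f : C -> R) (F : list C) : R := fold_right Rplus 0 (map f F).

Definition has_sum (A : C -> Prop) (f : C -> R) (l : R) : Prop :=
  forall eps, 0 < eps ->
    exists F0 : list C, NoDup F0 /\ (forall x, In x F0 -> A x) /\
      forall F : list C, NoDup F -> (forall x, In x F -> A x) -> incl F0 F ->
        Rabs (sum_list f F - l) < eps.

Definition summable (A : C -> Prop) (f : C -> R) : Prop := exists l, has_sum A f l.

Definition sumB (A : C -> Prop) (f : C -> R) : R :=
  match excluded_middle_informative (summable A f) with
  | left H => proj1_sig (constructive_indefinite_description _ H)
  | right _ => 0
  end.

Definition sigmaB (B : C -> Prop) : Rbar :=
  Glb_Rbar (fun s => 0 < s /\ exists z, Dset z /\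
              summable B (fun b => Rpower (Cmod (Cplus z b)) (- (2 * s)))).

Definition Lop (B : C -> Prop) (s : R) (v : C -> R) : C -> R :=
  fun z => sumB B (fun b => v (theta b z) / Rpower (Cmod (Cplus z b)) (2 * s)).

Definition continuous_onD (v : C -> R) : Prop :=
  forall z, Dset z -> forall eps, 0 < eps -> exists delta, 0 < delta /\
    forall w, Dset w -> Cmod (Cminus w z) < delta -> Rabs (v w - v z) < eps.

Definition opnorm (T : (C -> R) -> (C -> R)) : R :=
  real (Lub_Rbar (fun r => exists v, continuous_onD v /\
          (forall z, Dset z -> Rabs (v z) <= 1) /\
          exists z, Dset z /\ r = Rabs (T v z))).

Definition nroot (k : nat) (x : R) : R :=
  if Rle_dec x 0 then 0 else Rpower x (/ INR k).

Definition lipschitz_onD (v : C -> R) : Prop :=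
  exists K, forall z w, Dset z -> Dset w -> Rabs (v z - v w) <= K * Cmod (Cminus z w).

Definition openC (U : C -> Prop) : Prop :=
  forall z, U z -> exists r, 0 < r /\ forall w, Cmod (Cminus w z) < r -> U w.

Definition continuous_onU (U : C -> Prop) (f : C -> R) : Prop :=
  forall z, U z -> forall eps, 0 < eps -> exists delta, 0 < delta /\
    forall w, U w -> Cmod (Cminus w z) < delta -> Rabs (f w - f z) < eps.

Definition dx (f : C -> R) : C -> R := fun z => Derive (fun t => f (t, snd z)) (fst z).
Definition dy (f : C -> R) : C -> R := fun z => Derive (fun t => f (fst z, t)) (snd z).

Fixpoint Ck (k : nat) (U : C -> Prop) (f : C -> R) : Prop :=
  match k with
  | O => continuous_onU U f
  | S k' => (forall z, U z -> ex_derive (fun t => f (t, snd z)) (fst z) /\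
                              ex_derive (fun t => f (fst z, t)) (snd z))
            /\ continuous_onU U f /\ Ck k' U (dx f) /\ Ck k' U (dy f)
  end.

Definition smooth_onD (v : C -> R) : Prop :=
  exists (U : C -> Prop) (w : C -> R), openC U /\ (forall z, Dset z -> U z) /\
    (forall z, Dset z -> w z = v z) /\ forall k, Ck k U w.

(* Main.v *)
(* The distance |dz| / (1 + Re z) is contracted by 1/2 by every theta_b, while the weight
   |z + b|^(-2s) is log-Lipschitz. Hence L = L_s maps the cone of nonnegative functions with
   u(z) <= e^(16 s d(z,w)) u(w) into the smaller cone with 12 s in place of 16 s, and Birkhoff's
   argument shows that L^(k+1) 1 / L^k 1 converges geometrically to a constant lambda and that
   L^k 1, normalised at 0, converges geometrically to an eigenvector v.
   If w is another positive eigenvector, then it has the same eigenvalue by comparison with the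
   growth of L^k 1, and the largest t with t v <= w gives an eigenvector w - t v >= 0 of infimum 0,
   which the contraction forces to vanish.
   When B is finite, L^k 1 is a positive combination of functions |z + p|^(-2s) with Re p >= 1 and p
   bounded, because |theta_b z + p| |z + b| = |p| |z + b + 1/p|. Each of them decreases in Re z, and
   their derivatives of all orders are uniformly bounded, so the limit is smooth. *)
Require Import Defs.
From Stdlib Require Import Reals Lra Lia List Permutation FinFun ClassicalEpsilon.
From Coquelicot Require Import Coquelicot.
Open Scope R_scope.

(** * Unconditional sums *)

(** The exponents come from one balance. The weight costs [4 s] and the halved distance halves the
    rest, so a cone of exponent K is sent to exponent K/2 + 4 s: from 16 s this gives 12 s with room
    to spare, and 8 s is the fixed value. The room is what lets a small multiple of one function of
    the smaller cone be subtracted from another without leaving the larger cone; Birkhoff's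
    contraction is obtained from this subtraction alone, without a projective metric. The obstacle
    in the uniqueness proof is that a competing eigenvector is merely Lipschitz, so w - t v is not
    known to lie in any cone. Its failure to lie in the cone of exponent 8 s is an additive error K
    d(z,w), which is halved at each iteration relative to L^k 1 and thus disappears after division
    by lambda^k. Smoothness is out of reach of the cones, which control Lipschitz constants only.
    There positivity helps again: the coefficients are nonnegative, so the value at 0 bounds their
    sum, and this single bound controls the derivatives of every order. *)

Definition Ceq_dec (x y : C) : {x = y} + {x <> y} := excluded_middle_informative (x = y).

Definition lsum {T : Type} (f : T -> R) (l : list T) : R := fold_right Rplus 0 (map f l).

Lemma lsum_cons {T} (f : T -> R) a l : lsum f (a :: l) = f a + lsum f l.
Proof. reflexivity. Qed.

Lemma lsum_app {T} (f : T -> R) l m : lsum f (l ++ m) = lsum f l + lsum f m.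
Proof.
  induction l as [|a l IH]; [unfold lsum at 2; simpl; lra|].
  simpl app; rewrite !lsum_cons, IH; ring.
Qed.

Lemma lsum_scal {T} c (f : T -> R) l : lsum (fun x => c * f x) l = c * lsum f l.
Proof.
  induction l as [|a l IH]; [unfold lsum; simpl; lra|]. rewrite !lsum_cons, IH; ring.
Qed.

Lemma lsum_ext {T} (f g : T -> R) l : (forall x, In x l -> f x = g x) -> lsum f l = lsum g l.
Proof.
  induction l as [|a l IH]; intros H; [reflexivity|].
  rewrite !lsum_cons, IH, (H a); auto using in_eq, in_cons.
Qed.

Lemma lsum_le {T} (f g : T -> R) l : (forall x, In x l -> f x <= g x) -> lsum f l <= lsum g l.
Proof.
  induction l as [|a l IH]; intros H; [apply Rle_refl|].
  rewrite !lsum_cons; apply Rplus_le_compat; auto using in_eq, in_cons.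
Qed.

Lemma lsum_map {T U} (f : U -> R) (h : T -> U) l : lsum f (map h l) = lsum (fun x => f (h x)) l.
Proof. unfold lsum; now rewrite map_map. Qed.

Lemma lsum_flat_map {T U} (f : U -> R) (h : T -> list U) l :
  lsum f (flat_map h l) = lsum (fun x => lsum f (h x)) l.
Proof.
  induction l as [|a l IH]; [reflexivity|]. simpl; now rewrite lsum_app, lsum_cons, IH.
Qed.

Lemma lsum_abs {T} (f : T -> R) l : Rabs (lsum f l) <= lsum (fun x => Rabs (f x)) l.
Proof.
  induction l as [|a l IH]; [unfold lsum; simpl; rewrite Rabs_R0; lra|].
  rewrite !lsum_cons; eapply Rle_trans; [apply Rabs_triang|lra].
Qed.

Lemma lsum_lim {T} (f : nat -> T -> R) (g : T -> R) l :
  (forall x, In x l -> is_lim_seq (fun n => f n x) (g x)) ->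
  is_lim_seq (fun n => lsum (f n) l) (lsum g l).
Proof.
  induction l as [|a l IH]; intros H; [apply is_lim_seq_const|].
  apply is_lim_seq_plus'; auto using in_eq, in_cons.
Qed.

Lemma lsum_derive {T} (f f' : T -> R -> R) l x :
  (forall t, In t l -> is_derive (f t) x (f' t x)) ->
  is_derive (fun y => lsum (fun t => f t y) l) x (lsum (fun t => f' t x) l).
Proof.
  induction l as [|a l IH]; intros H; [apply (is_derive_const 0 x)|].
  apply (is_derive_plus (f a) (fun y => lsum (fun t => f t y) l)); auto using in_eq, in_cons.
Qed.

Lemma lsum_plus {T} (f g : T -> R) l : lsum (fun x => f x + g x) l = lsum f l + lsum g l.
Proof.
  induction l as [|a l IH]; [unfold lsum; simpl; lra|]. rewrite !lsum_cons, IH; ring.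
Qed.

Lemma lsum_ge0 {T} (f : T -> R) l : (forall x, In x l -> 0 <= f x) -> 0 <= lsum f l.
Proof.
  induction l as [|a l IH]; intros H; [apply Rle_refl|].
  rewrite lsum_cons; apply Rplus_le_le_0_compat; auto using in_eq, in_cons.
Qed.

Lemma lsum_incl {T} (f : T -> R) F G :
  NoDup F -> incl F G -> (forall x, In x G -> 0 <= f x) -> lsum f F <= lsum f G.
Proof.
  revert G; induction F as [|a F IH]; intros G HN HI HG.
  - now apply (lsum_ge0 f G).
  - destruct (in_split a G) as [G1 [G2 ->]]; [apply HI; now left|].
    inversion HN as [|a' F' Ha HF]; subst.
    assert (H : lsum f F <= lsum f (G1 ++ G2)).
    { apply IH; auto.
      - intros x Hx.
        assert (Hx' : In x (G1 ++ a :: G2)) by (apply HI; now right).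
        apply in_app_or in Hx'; apply in_or_app.
        destruct Hx' as [Hx'|[Hx'|Hx']]; auto; subst; contradiction.
      - intros x Hx; apply HG; apply in_app_or in Hx; apply in_or_app.
        destruct Hx; [left|right; right]; auto. }
    rewrite lsum_cons; rewrite lsum_app in *; rewrite lsum_cons; lra.
Qed.

Section HasSum.
Context (A : C -> Prop).

(** Finite subsets are directed by inclusion: the union of two witnesses serves both families. *)
Lemma has_sum_common f g l m eps :
  has_sum A f l -> has_sum A g m -> 0 < eps ->
  exists F, NoDup F /\ (forall x, In x F -> A x) /\
    (forall G, NoDup G -> (forall x, In x G -> A x) -> incl F G ->
       Rabs (lsum f G - l) < eps /\ Rabs (lsum g G - m) < eps).
Proof.
  intros Hf Hg He.
  destruct (Hf eps He) as [F1 [N1 [A1 H1]]], (Hg eps He) as [F2 [N2 [A2 H2]]].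
  exists (nodup Ceq_dec (F1 ++ F2)); repeat split.
  - apply NoDup_nodup.
  - intros x Hx; apply nodup_In, in_app_or in Hx; destruct Hx; auto.
  - apply H1; auto; intros x Hx; apply H3, nodup_In, in_or_app; auto.
  - apply H2; auto; intros x Hx; apply H3, nodup_In, in_or_app; auto.
Qed.

Lemma has_sum_le f g l m :
  (forall x, A x -> f x <= g x) -> has_sum A f l -> has_sum A g m -> l <= m.
Proof.
  intros H Hf Hg; apply Rnot_lt_le; intros Hlt.
  destruct (has_sum_common f g l m ((l - m) / 2) Hf Hg ltac:(lra)) as [F [N [HA HF]]].
  destruct (HF F N HA (incl_refl F)) as [H1 H2].
  assert (H3 := lsum_le f g F (fun x Hx => H x (HA x Hx))).
  apply Rabs_def2 in H1; apply Rabs_def2 in H2; lra.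
Qed.

Lemma has_sum_unique f l m : has_sum A f l -> has_sum A f m -> l = m.
Proof.
  intros Hl Hm; apply Rle_antisym; eapply has_sum_le; eauto; intros; lra.
Qed.

Lemma has_sum_ext f g l :
  (forall x, A x -> f x = g x) -> has_sum A f l -> has_sum A g l.
Proof.
  intros H Hf eps He; destruct (Hf eps He) as [F [N [HA HF]]].
  exists F; repeat split; auto; intros G NG AG IG.
  change (Rabs (lsum g G - l) < eps); rewrite <- (lsum_ext f g G); auto.
Qed.

Lemma has_sum_plus f g l m :
  has_sum A f l -> has_sum A g m -> has_sum A (fun x => f x + g x) (l + m).
Proof.
  intros Hf Hg eps He.
  destruct (has_sum_common f g l m (eps / 2) Hf Hg ltac:(lra)) as [F [N [HA HF]]].
  exists F; repeat split; auto; intros G NG AG IG.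
  destruct (HF G NG AG IG) as [H1 H2].
  change sum_list with (@lsum C); rewrite lsum_plus.
  apply Rabs_def2 in H1; apply Rabs_def2 in H2; apply Rabs_def1; lra.
Qed.

Lemma has_sum_scal c f l : has_sum A f l -> has_sum A (fun x => c * f x) (c * l).
Proof.
  intros Hf eps He.
  assert (Hc : 0 < Rabs c + 1) by (pose proof (Rabs_pos c); lra).
  destruct (Hf (eps / (Rabs c + 1)) ltac:(now apply Rdiv_lt_0_compat)) as [F [N [HA HF]]].
  exists F; repeat split; auto; intros G NG AG IG.
  specialize (HF G NG AG IG).
  change sum_list with (@lsum C) in *; rewrite lsum_scal.
  replace (c * lsum f G - c * l) with (c * (lsum f G - l)) by ring.
  rewrite Rabs_mult.
  apply Rle_lt_trans with (Rabs c * (eps / (Rabs c + 1))).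
  - apply Rmult_le_compat_l; [apply Rabs_pos|lra].
  - apply Rlt_le_trans with ((Rabs c + 1) * (eps / (Rabs c + 1))); [|right; field; lra].
    apply Rmult_lt_compat_r; [now apply Rdiv_lt_0_compat|lra].
Qed.

Lemma has_sum_ge_finite f l F :
  (forall x, A x -> 0 <= f x) -> has_sum A f l ->
  NoDup F -> (forall x, In x F -> A x) -> lsum f F <= l.
Proof.
  intros Hf Hl NF AF; apply Rnot_lt_le; intros Hlt.
  destruct (Hl (lsum f F - l) ltac:(lra)) as [F0 [N0 [A0 H0]]].
  set (G := nodup Ceq_dec (F0 ++ F)).
  assert (AG : forall x, In x G -> A x).
  { intros x Hx; apply nodup_In, in_app_or in Hx; destruct Hx; auto. }
  assert (HG : lsum f F <= lsum f G).
  { apply lsum_incl; auto. intros x Hx; apply nodup_In, in_or_app; auto. }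
  specialize (H0 G (NoDup_nodup _ _) AG).
  assert (HI : incl F0 G) by (intros x Hx; apply nodup_In, in_or_app; auto).
  specialize (H0 HI); apply Rabs_def2 in H0.
  change sum_list with (@lsum C) in *; lra.
Qed.

(** Finite sums of nonnegative terms increase with the finite set, so their supremum is the sum. *)
Lemma summable_bounded f M :
  (forall x, A x -> 0 <= f x) ->
  (forall F, NoDup F -> (forall x, In x F -> A x) -> lsum f F <= M) -> summable A f.
Proof.
  intros Hf HM.
  destruct (completeness (fun r => exists F, NoDup F /\ (forall x, In x F -> A x) /\
                                   r = lsum f F)) as [l [Hl1 Hl2]].
  - exists M; intros r [F [N [HA ->]]]; auto.
  - exists (lsum f nil), nil; repeat split; [constructor|intros x []].
  - exists l; intros eps He.
    destruct (excluded_middle_informative (exists F, NoDup F /\ (forall x, In x F -> A x) /\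
                l - eps < lsum f F)) as [[F [N [HA HF]]]|Hno].
    + exists F; repeat split; auto; intros G NG AG IG.
      assert (lsum f F <= lsum f G) by (apply lsum_incl; auto).
      assert (lsum f G <= l) by (apply Hl1; now exists G).
      change sum_list with (@lsum C); apply Rabs_def1; lra.
    + assert (l <= l - eps); [|lra].
      apply Hl2; intros r [F [N [HA ->]]]; apply Rnot_lt_le; intros Hlt; apply Hno; now exists F.
Qed.

(** Signs are removed by writing f = (f + g) - g, where 0 <= f + g <= 2 g. *)
Lemma summable_dom f g :
  (forall x, A x -> Rabs (f x) <= g x) -> summable A g -> summable A f.
Proof.
  intros H [l Hl].
  assert (Hpos : forall h, (forall x, A x -> 0 <= h x <= 2 * g x) -> summable A h).
  { intros h Hh; apply (summable_bounded h (2 * l)); [intros x Hx; now apply Hh|].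
    intros F N HA. apply Rle_trans with (lsum (fun x => 2 * g x) F).
    - apply lsum_le; intros x Hx; now apply Hh, HA.
    - rewrite lsum_scal; apply Rmult_le_compat_l; [lra|].
      apply (has_sum_ge_finite g); auto.
      intros x Hx; pose proof (Rabs_pos (f x)); specialize (H x Hx); lra. }
  destruct (Hpos (fun x => f x + g x)) as [m Hm].
  { intros x Hx; specialize (H x Hx); apply Rabs_le_between in H; lra. }
  exists (m + (-1) * l).
  apply has_sum_ext with (fun x => (f x + g x) + (-1) * g x); [intros; ring|].
  apply has_sum_plus; auto; now apply has_sum_scal.
Qed.

Lemma sumB_spec f : summable A f -> has_sum A f (sumB A f).
Proof.
  intros H; unfold sumB; destruct (excluded_middle_informative _) as [H'|]; [|contradiction].
  exact (proj2_sig (constructive_indefinite_description _ H')).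
Qed.

Lemma sumB_eq f l : has_sum A f l -> sumB A f = l.
Proof.
  intros H; apply (has_sum_unique f); auto; apply sumB_spec; now exists l.
Qed.

Lemma sumB_plus f g : summable A f -> summable A g ->
  sumB A (fun x => f x + g x) = sumB A f + sumB A g.
Proof. intros Hf Hg; apply sumB_eq, has_sum_plus; now apply sumB_spec. Qed.

Lemma sumB_scal c f : summable A f -> sumB A (fun x => c * f x) = c * sumB A f.
Proof. intros Hf; apply sumB_eq, has_sum_scal; now apply sumB_spec. Qed.

Lemma sumB_le f g : summable A f -> summable A g ->
  (forall x, A x -> f x <= g x) -> sumB A f <= sumB A g.
Proof.
  intros Hf Hg H; apply (has_sum_le f g); auto; now apply sumB_spec.
Qed.

Lemma summable_ext f g : (forall x, A x -> f x = g x) -> summable A f -> summable A g.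
Proof. intros H [l Hl]; exists l; now apply has_sum_ext with f. Qed.

Lemma sumB_ext f g : (forall x, A x -> f x = g x) -> sumB A f = sumB A g.
Proof.
  intros H; destruct (excluded_middle_informative (summable A f)) as [Hs|Hs].
  - apply eq_sym, sumB_eq, has_sum_ext with f; auto; now apply sumB_spec.
  (* Neither family is summable, and both sides take the default value 0. *)
  - assert (Hs' : ~ summable A g).
    { intros Hg; apply Hs; apply summable_ext with g; auto; intros; symmetry; auto. }
    unfold sumB; destruct (excluded_middle_informative (summable A f)); [contradiction|].
    destruct (excluded_middle_informative (summable A g)); [contradiction|reflexivity].
Qed.

Lemma sumB_ge_term f a : summable A f -> (forall x, A x -> 0 <= f x) -> A a -> f a <= sumB A f.
Proof.
  intros Hs Hf Ha.
  replace (f a) with (lsum f (a :: nil)) by (unfold lsum; simpl; lra).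
  apply has_sum_ge_finite; auto.
  - now apply sumB_spec.
  - constructor; [intros []|constructor].
  - intros x [<-|[]]; auto.
Qed.

Lemma has_sum_involution (h : C -> C) f l :
  (forall x, h (h x) = x) -> (forall x, A x -> A (h x)) ->
  has_sum A f l -> has_sum A (fun x => f (h x)) l.
Proof.
  intros Hh HA Hf eps He; destruct (Hf eps He) as [F [N [AF HF]]].
  assert (Hinj : forall G, NoDup G -> NoDup (map h G)).
  { intros G; apply Injective_map_NoDup; intros x y Hxy.
    now rewrite <- (Hh x), Hxy. }
  exists (map h F); repeat split; auto.
  - intros x Hx; apply in_map_iff in Hx; destruct Hx as [y [<- Hy]]; auto.
  - intros G NG AG IG; change sum_list with (@lsum C); rewrite <- (lsum_map f h).
    apply HF; auto.
    + intros x Hx; apply in_map_iff in Hx; destruct Hx as [y [<- Hy]]; auto.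
    + intros x Hx; rewrite <- (Hh x); apply in_map, IG, in_map, Hx.
Qed.

(** A duplicate-free list that contains F and stays in A is a permutation of F. *)
Lemma has_sum_lsum F f :
  NoDup F -> (forall x, A x <-> In x F) -> has_sum A f (lsum f F).
Proof.
  intros N HF eps He; exists F; repeat split; auto; [apply HF|].
  intros G NG AG IG.
  change sum_list with (@lsum C); replace (lsum f G) with (lsum f F).
  { unfold Rminus; rewrite Rplus_opp_r, Rabs_R0; lra. }
  assert (HP : Permutation F G).
  { apply NoDup_Permutation; auto.
    intros x; split; [apply IG|]; intros Hx; now apply HF, AG. }
  clear -HP; induction HP; auto; rewrite ?lsum_cons; [rewrite IHHP; lra|lra|congruence].
Qed.

End HasSum.

(** * The contracted distance *)

Lemma exp_le x y : x <= y -> exp x <= exp y.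
Proof. intros [H| ->]; [left; now apply exp_increasing|apply Rle_refl]. Qed.

Lemma Cmod_sqr (z : C) : Cmod z * Cmod z = fst z * fst z + snd z * snd z.
Proof. unfold Cmod; rewrite sqrt_sqrt; nra. Qed.

Lemma Dset_iff (z : C) : Dset z <-> fst z * fst z + snd z * snd z <= fst z.
Proof.
  unfold Dset.
  assert (H := Cmod_sqr (z - RtoC (1/2))); assert (H0 := Cmod_ge_0 (z - RtoC (1/2))).
  destruct z as [x y]; simpl in *; split; intros; nra.
Qed.

Lemma Dset_re (z : C) : Dset z -> 0 <= fst z <= 1.
Proof. intros H; apply Dset_iff in H; nra. Qed.

Lemma Dset_0 : Dset 0.
Proof. apply Dset_iff; simpl; lra. Qed.

Lemma Dset_dist z w : Dset z -> Dset w -> Cmod (z - w) <= 1.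
Proof.
  unfold Dset; intros Hz Hw.
  replace (z - w)%C with ((z - RtoC (1/2)) + - (w - RtoC (1/2)))%C by ring.
  eapply Rle_trans; [apply Cmod_triangle|]; rewrite Cmod_opp; lra.
Qed.

Lemma Dset_conj z : Dset z -> Dset (Cconj z).
Proof. intros H; apply Dset_iff in H; apply Dset_iff; destruct z; simpl in *; lra. Qed.

Lemma I1_re (b : C) : I1 b -> 1 <= fst b.
Proof. intros [m [n [Hm ->]]]; simpl; now apply IZR_le. Qed.

Lemma Cmod_ge_re (z : C) : fst z <= Cmod z.
Proof. pose proof (re_le_Cmod z); pose proof (Rle_abs (Re z)); unfold Re in *; lra. Qed.

Lemma pos_re_neq0 (z : C) : 0 < fst z -> z <> RtoC 0.
Proof. intros H ->; simpl in H; lra. Qed.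

Lemma fst_inv (u : C) : 0 < fst u -> fst (/ u)%C = fst u / (Cmod u * Cmod u).
Proof. intros H; rewrite Cmod_sqr; destruct u; simpl in *; field; nra. Qed.

(** D is the image of the half plane Re u >= 1 under inversion, with 0 added: |1/u|^2 = 1/|u|^2 <=
    Re u / |u|^2 = Re (1/u). *)
Lemma Dset_inv (u : C) : 1 <= fst u -> Dset (/ u).
Proof.
  intros H; apply Dset_iff; destruct u as [x y]; simpl in *.
  assert (HN : 0 < x * x + y * y) by nra.
  replace (x * (x * 1) + y * (y * 1)) with (x * x + y * y) by ring.
  replace (x / (x * x + y * y) * (x / (x * x + y * y)) +
           - y / (x * x + y * y) * (- y / (x * x + y * y)))
    with (/ (x * x + y * y)) by (field; lra).
  unfold Rdiv; rewrite <- (Rmult_1_l (/ (x * x + y * y))) at 1.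
  apply Rmult_le_compat_r; auto; left; now apply Rinv_0_lt_compat.
Qed.

Lemma theta_D (b z : C) : 1 <= fst b -> 0 <= fst z -> Dset (theta b z).
Proof. intros Hb Hz; apply Dset_inv; destruct b, z; simpl in *; lra. Qed.

(* The distance |dz| / (1 + Re z), in chordal form: every theta_b contracts it by 1/2,
   whereas theta_1 does not contract the Euclidean distance at 0. *)
Definition dH (z w : C) : R := Cmod (z - w) / sqrt ((1 + fst z) * (1 + fst w)).

Lemma dH_sym (z w : C) : dH z w = dH w z.
Proof.
  unfold dH; rewrite Rmult_comm; f_equal.
  rewrite <- Cmod_opp; f_equal; ring.
Qed.

Lemma sqrt_re_ge1 (z w : C) : 0 <= fst z -> 0 <= fst w -> 1 <= sqrt ((1 + fst z) * (1 + fst w)).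
Proof. intros; rewrite <- sqrt_1 at 1; apply sqrt_le_1_alt; nra. Qed.

Lemma dH_ge0 (z w : C) : 0 <= fst z -> 0 <= fst w -> 0 <= dH z w.
Proof.
  intros Hz Hw; pose proof (sqrt_re_ge1 z w Hz Hw).
  apply Rmult_le_pos; [apply Cmod_ge_0|left; apply Rinv_0_lt_compat; lra].
Qed.

Lemma dH_le_Cmod (z w : C) : 0 <= fst z -> 0 <= fst w -> dH z w <= Cmod (z - w).
Proof.
  intros Hz Hw; pose proof (sqrt_re_ge1 z w Hz Hw); pose proof (Cmod_ge_0 (z - w)).
  unfold dH; apply Rle_div_l; [lra|nra].
Qed.

Lemma Cmod_le_dH z w : Dset z -> Dset w -> Cmod (z - w) <= 2 * dH z w.
Proof.
  intros Hz Hw; apply Dset_re in Hz; apply Dset_re in Hw.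
  pose proof (sqrt_re_ge1 z w ltac:(lra) ltac:(lra)); pose proof (Cmod_ge_0 (z - w)).
  assert (sqrt ((1 + fst z) * (1 + fst w)) <= 2).
  { replace 2 with (sqrt (2 * 2)) by (apply sqrt_square; lra). apply sqrt_le_1_alt; nra. }
  unfold dH; apply Rmult_le_reg_r with (sqrt ((1 + fst z) * (1 + fst w))); [lra|].
  replace (2 * (Cmod (z - w) / sqrt ((1 + fst z) * (1 + fst w))) *
           sqrt ((1 + fst z) * (1 + fst w))) with (2 * Cmod (z - w)) by (field; lra).
  nra.
Qed.

Lemma dH_le1 z w : Dset z -> Dset w -> dH z w <= 1.
Proof.
  intros Hz Hw; pose proof (Dset_dist z w Hz Hw); apply Dset_re in Hz; apply Dset_re in Hw.
  pose proof (dH_le_Cmod z w); lra.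
Qed.

Lemma theta_diff (b z w : C) : 0 < fst (z + b)%C -> 0 < fst (w + b)%C ->
  Cmod (theta b z - theta b w) = Cmod (z - w) / (Cmod (z + b) * Cmod (w + b)).
Proof.
  intros Hz Hw; apply pos_re_neq0 in Hz; apply pos_re_neq0 in Hw; unfold theta.
  replace (/ (z + b) - / (w + b))%C with (- (z - w) / ((z + b) * (w + b)))%C
    by (field; auto).
  rewrite Cmod_div, Cmod_opp, Cmod_mult; auto; now apply Cmult_neq_0.
Qed.

(** The identity [theta_diff] is exact, so the two-point inequality splits into one inequality for
    each of z and w. With t = Re (z + b) >= 1 + Re z >= 1 it reads |z + b|^2 + t >= t^2 + t >= 2 t
    >= 2 (1 + Re z). *)
Lemma dH_theta (b z w : C) : 1 <= fst b -> 0 <= fst z -> 0 <= fst w ->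
  dH (theta b z) (theta b w) <= dH z w / 2.
Proof.
  intros Hb Hz Hw.
  assert (Hre : forall z : C, 0 <= fst z ->
    0 < fst (z + b)%C /\ 0 < Cmod (z + b) /\
    2 * (1 + fst z) <= (Cmod (z + b) * Cmod (z + b)) * (1 + fst (theta b z))).
  { intros u Hu. assert (H1 : 1 + fst u <= fst (u + b)%C) by (destruct u, b; simpl in *; lra).
    pose proof (Cmod_ge_re (u + b)) as H2.
    split; [lra|split; [lra|]].
    unfold theta; rewrite fst_inv by lra.
    replace (Cmod (u + b) * Cmod (u + b) * (1 + fst (u + b)%C / (Cmod (u + b) * Cmod (u + b))))
      with (Cmod (u + b) * Cmod (u + b) + fst (u + b)%C) by (field; lra).
    nra. }
  destruct (Hre z Hz) as [Az [Pz Iz]], (Hre w Hw) as [Aw [Pw Iw]].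
  unfold dH; rewrite theta_diff by auto.
  set (P := Cmod (z + b)) in *; set (Q := Cmod (w + b)) in *.
  set (u := 1 + fst (theta b z)) in *; set (v := 1 + fst (theta b w)) in *.
  assert (Hu : 0 < u) by (apply Rmult_lt_reg_l with (P * P); nra).
  assert (Hv : 0 < v) by (apply Rmult_lt_reg_l with (Q * Q); nra).
  assert (HS : 2 * sqrt ((1 + fst z) * (1 + fst w)) <= P * Q * sqrt (u * v)).
  { replace (2 * sqrt ((1 + fst z) * (1 + fst w)))
      with (sqrt ((2 * (1 + fst z)) * (2 * (1 + fst w)))).
    2:{ replace (2 * (1 + fst z) * (2 * (1 + fst w)))
          with ((2 * 2) * ((1 + fst z) * (1 + fst w))) by ring.
        rewrite sqrt_mult_alt, sqrt_square; lra. }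
    replace (P * Q * sqrt (u * v)) with (sqrt ((P * P * u) * (Q * Q * v))).
    - apply sqrt_le_1_alt; apply Rmult_le_compat; lra.
    - replace (P * P * u * (Q * Q * v)) with (((P * Q) * (P * Q)) * (u * v)) by ring.
      rewrite sqrt_mult_alt, sqrt_square; nra. }
  pose proof (sqrt_re_ge1 z w Hz Hw); pose proof (Cmod_ge_0 (z - w)).
  assert (0 < sqrt (u * v)) by (apply sqrt_lt_R0; nra).
  replace (Cmod (z - w) / (P * Q) / sqrt (u * v)) with (Cmod (z - w) * / (P * Q * sqrt (u * v)))
    by (field; repeat split; lra).
  replace (Cmod (z - w) / sqrt ((1 + fst z) * (1 + fst w)) / 2)
    with (Cmod (z - w) * / (2 * sqrt ((1 + fst z) * (1 + fst w)))) by (field; lra).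
  apply Rmult_le_compat_l; auto; apply Rinv_le_contravar; lra.
Qed.

(** * Variation of the weights *)

Section Weights.
Context (s : R) (Hs : 0 < s).

(** The unit in which cone exponents are counted: [qd z w ^ n] is e^(-4 n s d), so the exponents 12
    s and 16 s are n = 3 and n = 4. *)
Definition qd (z w : C) : R := exp (- (4 * s * dH z w)).

Lemma qd_sym z w : qd z w = qd w z.
Proof. unfold qd; now rewrite dH_sym. Qed.

Lemma qd_pos z w : 0 < qd z w.
Proof. apply exp_pos. Qed.

Lemma qd_le1 z w : Dset z -> Dset w -> qd z w <= 1.
Proof.
  intros Hz Hw; apply Dset_re in Hz; apply Dset_re in Hw.
  pose proof (dH_ge0 z w ltac:(lra) ltac:(lra)).
  unfold qd; rewrite <- exp_0; apply exp_le; nra.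
Qed.

Lemma qd_ge z w : Dset z -> Dset w -> exp (- (4 * s)) <= qd z w.
Proof. intros Hz Hw; pose proof (dH_le1 z w Hz Hw); apply exp_le; nra. Qed.

Lemma qd_theta (b z w : C) : 1 <= fst b -> Dset z -> Dset w ->
  qd z w <= qd (theta b z) (theta b w) ^ 2.
Proof.
  intros Hb Hz Hw; apply Dset_re in Hz; apply Dset_re in Hw.
  pose proof (dH_theta b z w Hb ltac:(lra) ltac:(lra)).
  unfold qd; simpl; rewrite Rmult_1_r, <- exp_plus; apply exp_le; nra.
Qed.

Definition wt (b z : C) : R := / Rpower (Cmod (z + b)) (2 * s).

Lemma wt_pos b z : 0 < wt b z.
Proof. apply Rinv_0_lt_compat, exp_pos. Qed.

(** Since |z + b| >= 1 and |z - w| <= 2 d, one has |w + b| <= |z + b| (1 + 2 d) <= |z + b| e^(2 d).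
    The power 2 s of this is where 4 s comes from. *)
Lemma wt_qd (b z w : C) : 1 <= fst b -> Dset z -> Dset w -> qd z w * wt b z <= wt b w.
Proof.
  intros Hb Hz Hw.
  assert (Hd := Cmod_le_dH z w Hz Hw); assert (H0 := Cmod_ge_0 (z - w)).
  assert (Hz' := Dset_re z Hz); assert (Hw' := Dset_re w Hw).
  assert (H1 : 1 <= fst (z + b)%C) by (destruct z, b; simpl in *; lra).
  assert (H1' : 1 <= fst (w + b)%C) by (destruct w, b; simpl in *; lra).
  pose proof (Cmod_ge_re (z + b)) as H2; pose proof (Cmod_ge_re (w + b)) as H2'.
  assert (H3 : Cmod (w + b) <= Cmod (z + b) * exp (2 * dH z w)).
  { apply Rle_trans with (Cmod (z + b) + Cmod (z - w)).
    - rewrite <- (Cmod_opp (z - w)).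
      replace (w + b)%C with ((z + b) + - (z - w))%C by ring. apply Cmod_triangle.
    - pose proof (exp_ineq1_le (2 * dH z w)); nra. }
  unfold wt, qd; rewrite exp_Ropp, <- Rinv_mult.
  apply Rinv_le_contravar; [apply exp_pos|].
  apply Rle_trans with (Rpower (Cmod (z + b) * exp (2 * dH z w)) (2 * s)).
  - apply Rle_Rpower_l; lra.
  - rewrite <- Rpower_mult_distr; [|lra|apply exp_pos].
    right; rewrite Rmult_comm; f_equal.
    unfold Rpower; rewrite ln_exp; f_equal; ring.
Qed.

End Weights.

(** * Convergence of the series above the abscissa *)

Lemma sigmaB_pos_witness B s : Rbar_lt (sigmaB B) (Finite s) ->
  exists s0 z, 0 < s0 < s /\ Dset z /\
    summable B (fun b => Rpower (Cmod (z + b)) (- (2 * s0))).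
Proof.
  intros H; unfold sigmaB in H.
  set (E := fun s : R => _) in H.
  destruct (Glb_Rbar_correct E) as [_ HG].
  destruct (excluded_middle_informative (exists s0, E s0 /\ s0 < s)) as [[s0 [[Hp [z [Hz Hsum]]] Hlt]]|Hno].
  - exists s0, z; auto.
  - exfalso; apply (Rbar_lt_not_le _ _ H), HG.
    intros x Hx; simpl; apply Rnot_lt_le; intros Hlt; apply Hno; now exists x.
Qed.

(** Moving the base point from z0 to z costs at most e^(4 s0), by [wt_qd] and d <= 1; raising the
    exponent from s0 to s only shrinks the terms because |z + b| >= 1. *)
Lemma summable_wt B s : (forall b, B b -> I1 b) -> Rbar_lt (sigmaB B) (Finite s) ->
  0 < s /\ forall z, Dset z -> summable B (fun b => wt s b z).
Proof.
  intros HB H; destruct (sigmaB_pos_witness B s H) as [s0 [z0 [Hs [Hz0 Hsum]]]].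
  split; [lra|intros z Hz].
  apply summable_dom with (fun b => exp (4 * s0) * Rpower (Cmod (z0 + b)) (- (2 * s0))).
  2:{ destruct Hsum as [l Hl]; eexists; apply has_sum_scal, Hl. }
  intros b Hb; apply HB, I1_re in Hb.
  rewrite Rabs_right by (apply Rle_ge; left; apply wt_pos).
  assert (H1 := wt_qd s0 ltac:(lra) b z z0 Hb Hz Hz0).
  assert (H2 := qd_ge s0 ltac:(lra) z z0 Hz Hz0).
  rewrite exp_Ropp in H2; rewrite Rpower_Ropp; fold (wt s0 b z0).
  assert (H3 : wt s b z <= wt s0 b z).
  { apply Rinv_le_contravar; [apply exp_pos|]. apply Rle_Rpower; [|lra].
    pose proof (Cmod_ge_re (z + b)); apply Dset_re in Hz; destruct z, b; simpl in *; lra. }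
  apply Rle_trans with (1 := H3).
  pose proof (wt_pos s0 b z); pose proof (exp_pos (4 * s0)).
  apply Rmult_le_reg_l with (/ exp (4 * s0)); [now apply Rinv_0_lt_compat|].
  rewrite <- Rmult_assoc, Rinv_l, Rmult_1_l by lra.
  apply Rle_trans with (qd s0 z z0 * wt s0 b z); auto.
  apply Rmult_le_compat_r; lra.
Qed.

(** * Invariant cones and the eigenvector *)

Ltac splits := repeat match goal with |- _ /\ _ => split end.

(** With e = M / (1 - g) the intervals of centre u k and radius e g^k are nested; the supremum of
    their left ends lies in all of them. *)
Lemma geometric_cauchy (u : nat -> R) (M g : R) : 0 < g < 1 ->
  (forall k, Rabs (u (S k) - u k) <= M * g ^ k) ->
  exists l, forall k, Rabs (u k - l) <= M / (1 - g) * g ^ k.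
Proof.
  intros Hg Hu; set (e := M / (1 - g)).
  assert (He : M = e * (1 - g)) by (unfold e; field; lra).
  assert (Hlo : forall n k, u k - e * g ^ k <= u (k + n)%nat - e * g ^ (k + n)).
  { induction n as [|n IH]; intros k; [rewrite Nat.add_0_r; lra|].
    apply Rle_trans with (1 := IH k); rewrite Nat.add_succ_r; simpl pow.
    specialize (Hu (k + n)%nat); apply Rabs_le_between in Hu; rewrite He in Hu; lra. }
  assert (Hhi : forall n k, u (k + n)%nat + e * g ^ (k + n) <= u k + e * g ^ k).
  { induction n as [|n IH]; intros k; [rewrite Nat.add_0_r; lra|].
    apply Rle_trans with (2 := IH k); rewrite Nat.add_succ_r; simpl pow.
    specialize (Hu (k + n)%nat); apply Rabs_le_between in Hu; rewrite He in Hu; lra. }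
  assert (He0 : 0 <= e).
  { assert (0 <= M) by (specialize (Hu O); pose proof (Rabs_pos (u 1%nat - u O)); simpl in Hu; lra).
    apply Rmult_le_pos; auto; left; apply Rinv_0_lt_compat; lra. }
  assert (Hcross : forall j k, u j - e * g ^ j <= u k + e * g ^ k).
  { intros j k; specialize (Hlo k j); specialize (Hhi j k); rewrite Nat.add_comm in Hhi.
    pose proof (pow_le g (j + k) ltac:(lra)); nra. }
  destruct (completeness (fun r => exists k, r = u k - e * g ^ k)) as [l [Hl1 Hl2]].
  - exists (u O + e * g ^ 0); intros r [k ->]; apply Hcross.
  - now exists (u O - e * g ^ 0), O.
  - exists l; intros k; apply Rabs_le_between'.
    assert (u k - e * g ^ k <= l) by (apply Hl1; now exists k).
    assert (l <= u k + e * g ^ k) by (apply Hl2; intros r [j ->]; apply Hcross).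
    lra.
Qed.

Lemma geometric_lim (u : nat -> R) (l M g : R) : 0 < g < 1 ->
  (forall k, Rabs (u k - l) <= M * g ^ k) -> is_lim_seq u l.
Proof.
  intros Hg Hu.
  assert (HM : is_lim_seq (fun k => M * g ^ k) 0).
  { replace (Finite 0) with (Rbar_mult M 0) by (simpl; f_equal; ring).
    apply is_lim_seq_scal_l, is_lim_seq_geom; rewrite Rabs_right; lra. }
  apply is_lim_seq_le_le with (fun k => l - M * g ^ k) (fun k => l + M * g ^ k).
  - intros k; apply Rabs_le_between', Hu.
  - replace (Finite l) with (Finite (l - 0)) by (f_equal; ring).
    apply is_lim_seq_minus'; [apply is_lim_seq_const|exact HM].
  - replace (Finite l) with (Finite (l + 0)) by (f_equal; ring).
    apply is_lim_seq_plus'; [apply is_lim_seq_const|exact HM].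
Qed.

Section Operator.
Context (B : C -> Prop) (HB : forall b, B b -> I1 b) (B0 : exists b, B b).
Context (s : R) (Hs : 0 < s).
Context (HW : forall z, Dset z -> summable B (fun b => wt s b z)).

Local Notation L := (Lop B s).
Local Notation q := (qd s).
Local Notation q0 := (exp (- (4 * s))).

Lemma B_re b : B b -> 1 <= fst b.
Proof. intros H; now apply I1_re, HB. Qed.

Lemma B_theta b z : B b -> Dset z -> Dset (theta b z).
Proof. intros Hb Hz; apply theta_D; [now apply B_re|now apply Dset_re]. Qed.

Lemma q0_bounds : 0 < q0 < 1.
Proof. split; [apply exp_pos|]. rewrite <- exp_0; apply exp_increasing; lra. Qed.

Definition bddD (u : C -> R) : Prop := exists M, forall z, Dset z -> Rabs (u z) <= M.

Lemma bddD_comb u v a b : bddD u -> bddD v -> bddD (fun z => a * u z + b * v z).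
Proof.
  intros [M HM] [N HN]; exists (Rabs a * M + Rabs b * N); intros z Hz.
  eapply Rle_trans; [apply Rabs_triang|]; rewrite !Rabs_mult.
  apply Rplus_le_compat; apply Rmult_le_compat_l; auto; apply Rabs_pos.
Qed.

Lemma bddD_scal u a : bddD u -> bddD (fun z => a * u z).
Proof.
  intros [M HM]; exists (Rabs a * M); intros z Hz.
  rewrite Rabs_mult; apply Rmult_le_compat_l; [apply Rabs_pos|auto].
Qed.

Lemma bddD_const c : bddD (fun _ => c).
Proof. exists (Rabs c); intros; apply Rle_refl. Qed.

Lemma LopE u z : L u z = sumB B (fun b => wt s b z * u (theta b z)).
Proof.
  apply sumB_ext; intros; unfold wt, Rdiv; ring.
Qed.

Lemma Lop_summable u z : bddD u -> Dset z -> summable B (fun b => wt s b z * u (theta b z)).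
Proof.
  intros [M HM] Hz; apply summable_dom with (fun b => M * wt s b z).
  - intros b Hb; rewrite Rabs_mult, Rabs_right, Rmult_comm by (left; apply wt_pos).
    apply Rmult_le_compat_r; [left; apply wt_pos|]. now apply HM, B_theta.
  - destruct (HW z Hz) as [l Hl]; eexists; apply has_sum_scal, Hl.
Qed.

Lemma Lop_ext u v z : (forall w, Dset w -> u w = v w) -> Dset z -> L u z = L v z.
Proof.
  intros H Hz; rewrite !LopE; apply sumB_ext; intros b Hb; rewrite H; auto; now apply B_theta.
Qed.

Lemma Lop_comb u v a b z : bddD u -> bddD v -> Dset z ->
  L (fun z => a * u z + b * v z) z = a * L u z + b * L v z.
Proof.
  intros Hu Hv Hz; rewrite !LopE.
  assert (Su := Lop_summable u z Hu Hz); assert (Sv := Lop_summable v z Hv Hz).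
  rewrite <- (sumB_scal B a), <- (sumB_scal B b), <- sumB_plus; auto.
  - apply sumB_ext; intros; ring.
  - destruct Su as [l Hl]; eexists; apply has_sum_scal, Hl.
  - destruct Sv as [l Hl]; eexists; apply has_sum_scal, Hl.
Qed.

Lemma Lop_scal u a z : bddD u -> Dset z -> L (fun z => a * u z) z = a * L u z.
Proof.
  intros Hu Hz; rewrite <- (Rplus_0_r (a * L u z)), <- (Rmult_0_l (L u z)).
  rewrite <- (Lop_comb u u a 0); auto; apply Lop_ext; auto; intros; ring.
Qed.

Lemma Lop_le u v z : bddD u -> bddD v -> Dset z ->
  (forall w, Dset w -> u w <= v w) -> L u z <= L v z.
Proof.
  intros Hu Hv Hz H; rewrite !LopE; apply sumB_le; try now apply Lop_summable.
  intros b Hb; apply Rmult_le_compat_l; [left; apply wt_pos|now apply H, B_theta].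
Qed.

Lemma Lop_ge_term u b z : bddD u -> (forall w, Dset w -> 0 <= u w) -> Dset z -> B b ->
  wt s b z * u (theta b z) <= L u z.
Proof.
  intros Hu H Hz Hb; rewrite LopE.
  apply (sumB_ge_term B (fun b => wt s b z * u (theta b z))); auto; [now apply Lop_summable|].
  intros c Hc; apply Rmult_le_pos; [left; apply wt_pos|now apply H, B_theta].
Qed.

Lemma Lop_nonneg u z : bddD u -> (forall w, Dset w -> 0 <= u w) -> Dset z -> 0 <= L u z.
Proof.
  intros Hb Hu Hz; destruct B0 as [b Hbb].
  apply Rle_trans with (2 := Lop_ge_term u b z Hb Hu Hz Hbb).
  apply Rmult_le_pos; [left; apply wt_pos|now apply Hu, B_theta].
Qed.

(** For positive u this says that ln u is 4 n s - Lipschitz for [dH]. The multiplicative form admits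
    functions with zeros and passes to sums and pointwise limits. *)
Definition fcone (n : nat) (u : C -> R) : Prop :=
  (forall z, Dset z -> 0 <= u z) /\
  (forall z w, Dset z -> Dset w -> q z w ^ n * u z <= u w).

(** A Harnack inequality: [dH] is at most 1 on D, so any two values are comparable. *)
Lemma fcone_upper n u z w : fcone n u -> Dset z -> Dset w -> q0 ^ n * u z <= u w.
Proof.
  intros [H1 H2] Hz Hw; apply Rle_trans with (2 := H2 z w Hz Hw).
  apply Rmult_le_compat_r; auto; apply pow_incr; split; [left; apply exp_pos|now apply qd_ge].
Qed.

Lemma fcone_bdd n u : fcone n u -> bddD u.
Proof.
  intros Hu; exists (u (RtoC 0) / q0 ^ n); intros z Hz.
  rewrite Rabs_right by (apply Rle_ge; now apply Hu).
  pose proof (fcone_upper n u z 0 Hu Hz Dset_0).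
  pose proof (pow_lt q0 n (proj1 q0_bounds)).
  apply Rmult_le_reg_l with (q0 ^ n); auto.
  replace (q0 ^ n * (u (RtoC 0) / q0 ^ n)) with (u (RtoC 0)) by (field; lra); auto.
Qed.

Lemma fcone_ext n u v : (forall z, Dset z -> u z = v z) -> fcone n u -> fcone n v.
Proof.
  intros H [H1 H2]; split; intros; rewrite <- ?H; auto.
Qed.

Lemma fcone_comb n u v a b : fcone n u -> fcone n v -> 0 <= a -> 0 <= b ->
  fcone n (fun z => a * u z + b * v z).
Proof.
  intros [Hu1 Hu2] [Hv1 Hv2] Ha Hb; split; intros.
  - apply Rplus_le_le_0_compat; apply Rmult_le_pos; auto.
  - replace (q z w ^ n * (a * u z + b * v z)) with
      (a * (q z w ^ n * u z) + b * (q z w ^ n * v z)) by ring.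
    apply Rplus_le_compat; apply Rmult_le_compat_l; auto.
Qed.

Lemma fcone_weaken n u : fcone n u -> fcone (S n) u.
Proof.
  intros [H1 H2]; split; auto; intros z w Hz Hw.
  apply Rle_trans with (2 := H2 z w Hz Hw); apply Rmult_le_compat_r; auto; simpl.
  rewrite <- (Rmult_1_l (q z w ^ n)) at 2; apply Rmult_le_compat_r.
  - apply pow_le; left; apply qd_pos.
  - now apply qd_le1.
Qed.

Lemma fcone_const n c : 0 <= c -> fcone n (fun _ => c).
Proof.
  intros Hc; split; intros z; auto; intros w Hz Hw.
  assert (q z w ^ n <= 1); [|nra].
  rewrite <- (pow1 n); apply pow_incr; split; [left; apply qd_pos|now apply qd_le1].
Qed.

(** Term by term, one factor [q] is absorbed by the weight, and the other two become four at the
    images under [theta]: 3 = 1 + 4/2. *)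
Lemma fcone_Lop u : fcone 4 u -> fcone 3 (L u).
Proof.
  intros Hu; assert (Hb := fcone_bdd 4 u Hu); split.
  - intros z Hz; apply Lop_nonneg; auto; apply Hu.
  - intros z w Hz Hw; rewrite !LopE.
    rewrite <- sumB_scal by now apply Lop_summable.
    apply sumB_le.
    + destruct (Lop_summable u z Hb Hz) as [l Hl]; eexists; apply has_sum_scal, Hl.
    + now apply Lop_summable.
    + intros b Hbb.
      assert (H1 := wt_qd s Hs b z w (B_re b Hbb) Hz Hw).
      assert (H2 := qd_theta s Hs b z w (B_re b Hbb) Hz Hw).
      assert (Tz := B_theta b z Hbb Hz); assert (Tw := B_theta b w Hbb Hw).
      destruct Hu as [Hu1 Hu2].
      specialize (Hu2 _ _ Tz Tw); specialize (Hu1 _ Tz).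
      pose proof (qd_pos s z w); pose proof (wt_pos s b z).
      replace (q z w ^ 3 * (wt s b z * u (theta b z)))
        with ((q z w * wt s b z) * (q z w ^ 2 * u (theta b z))) by ring.
      apply Rmult_le_compat; auto; [nra|apply Rmult_le_pos; nra|].
      apply Rle_trans with (2 := Hu2); apply Rmult_le_compat_r; auto.
      replace (qd s (theta b z) (theta b w) ^ 4)
        with ((qd s (theta b z) (theta b w) ^ 2) ^ 2) by ring.
      apply pow_incr; lra.
Qed.

(** [fcone_sub] needs 7 t h2 <= h1 on all of D but is given a comparison at 0 only; carrying it to
    other points costs [q0 ^ 3] for each of the two functions. *)
Definition cc : R := q0 ^ 6 / 7.

Lemma cc_bounds : 0 < cc < 1.
Proof.
  unfold cc; pose proof q0_bounds as H; pose proof (pow_lt q0 6 (proj1 H)).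
  assert (q0 ^ 6 <= 1) by (rewrite <- (pow1 6); apply pow_incr; lra). lra.
Qed.

(* The constant 7 is Bernoulli's: [1 - x^7 <= 7 (1 - x)] for [0 <= x <= 1]. *)
Lemma fcone_sub h1 h2 t : fcone 3 h1 -> fcone 3 h2 -> 0 <= t ->
  t * h2 (RtoC 0) <= cc * h1 (RtoC 0) -> fcone 4 (fun z => h1 z - t * h2 z).
Proof.
  intros H1 H2 Ht Hc.
  assert (Hd : forall z, Dset z -> 7 * (t * h2 z) <= h1 z).
  { intros z Hz.
    assert (A1 := fcone_upper 3 h1 0 z H1 Dset_0 Hz).
    assert (A2 := fcone_upper 3 h2 z 0 H2 Hz Dset_0).
    pose proof q0_bounds as Hq; pose proof (pow_lt q0 3 (proj1 Hq)) as Hq3.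
    unfold cc in Hc; apply Rmult_le_reg_l with (q0 ^ 3); auto.
    apply Rle_trans with (7 * (t * h2 (RtoC 0))); [nra|].
    apply Rle_trans with (q0 ^ 6 * h1 (RtoC 0)); [lra|].
    replace (q0 ^ 6 * h1 (RtoC 0)) with (q0 ^ 3 * (q0 ^ 3 * h1 (RtoC 0))) by ring.
    apply Rmult_le_compat_l; lra. }
  split.
  - intros z Hz; specialize (Hd z Hz).
    assert (0 <= t * h2 z) by (apply Rmult_le_pos; auto; now apply H2). lra.
  - intros z w Hz Hw; specialize (Hd w Hw).
    assert (A1 := proj2 H1 z w Hz Hw); assert (A2 := proj2 H2 w z Hw Hz).
    rewrite (qd_sym s w z) in A2.
    pose proof (qd_pos s z w) as Hp; pose proof (qd_le1 s Hs z w Hz Hw) as Hl.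
    assert (B2 : 0 <= t * h2 w) by (apply Rmult_le_pos; auto; now apply H2).
    set (x := q z w) in *.
    (* The spare factor x in front of h1 w gains (1 - x) h1 w, while exchanging h2 z for h2 w loses
       (1 - x^7) t h2 w. The claim is that the gain covers the loss. *)
    assert (A3 : x ^ 4 * h1 z <= x * h1 w) by (replace (x ^ 4) with (x * x ^ 3) by ring; nra).
    assert (A4 : x ^ 7 * (t * h2 w) <= x ^ 4 * (t * h2 z)).
    { replace (x ^ 7 * (t * h2 w)) with (x ^ 4 * (t * (x ^ 3 * h2 w))) by ring.
      apply Rmult_le_compat_l; [apply pow_le; lra|]. apply Rmult_le_compat_l; auto. }
    assert (A5 : (1 - x ^ 7) * (t * h2 w) <= (1 - x) * h1 w).
    { assert (E7 : 1 - x ^ 7 = (1 - x) * (1 + x + x^2 + x^3 + x^4 + x^5 + x^6)) by ring.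
      assert (P : forall n, 0 <= x ^ n <= 1).
      { intros n; split; [apply pow_le; lra|rewrite <- (pow1 n); apply pow_incr; lra]. }
      rewrite E7, Rmult_assoc; apply Rmult_le_compat_l; [lra|].
      apply Rle_trans with (2 := Hd); apply Rmult_le_compat_r; auto.
      pose proof (P 2%nat); pose proof (P 3%nat); pose proof (P 4%nat);
      pose proof (P 5%nat); pose proof (P 6%nat); lra. }
    lra.
Qed.

Definition Lpow1 (k : nat) : C -> R := Nat.iter k L (fun _ => 1).

Lemma Lpow1_S k : Lpow1 (S k) = L (Lpow1 k).
Proof. reflexivity. Qed.

Lemma Lpow1_cone k : fcone 3 (Lpow1 k).
Proof.
  induction k as [|k IH]; [apply fcone_const; lra|].
  rewrite Lpow1_S; now apply fcone_Lop, fcone_weaken.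
Qed.

Lemma Lpow1_bdd k : bddD (Lpow1 k).
Proof. exact (fcone_bdd 3 _ (Lpow1_cone k)). Qed.

Lemma Lop_pos u z : fcone 4 u -> (forall w, Dset w -> 0 < u w) -> Dset z -> 0 < L u z.
Proof.
  intros Hc Hu Hz; destruct B0 as [b Hb].
  apply Rlt_le_trans with (wt s b z * u (theta b z)).
  - apply Rmult_lt_0_compat; [apply wt_pos|now apply Hu, B_theta].
  - apply Lop_ge_term; auto; [now apply fcone_bdd with 4%nat|apply Hc].
Qed.

Lemma Lpow1_pos k z : Dset z -> 0 < Lpow1 k z.
Proof.
  revert z; induction k as [|k IH]; intros z Hz; [unfold Lpow1; simpl; lra|].
  rewrite Lpow1_S; apply Lop_pos; auto; apply fcone_weaken, Lpow1_cone.
Qed.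

Lemma Lop_bdd u : bddD u -> bddD (L u).
Proof.
  intros Hu; assert (Hu' := Hu); destruct Hu' as [M HM].
  destruct (Lpow1_bdd 1) as [N HN]; exists (M * N); intros z Hz.
  assert (HM0 : 0 <= M) by (eapply Rle_trans; [apply Rabs_pos|apply (HM _ Dset_0)]).
  assert (E : forall c, L (fun w => c * Lpow1 0 w) z = c * Lpow1 1 z)
    by (intros c; rewrite Lop_scal by (auto; apply Lpow1_bdd); reflexivity).
  assert (H : Rabs (L u z) <= M * Lpow1 1 z).
  { apply Rabs_le; replace (- (M * Lpow1 1 z)) with ((- M) * Lpow1 1 z) by ring; rewrite <- !E.
    split; apply Lop_le; auto; try (apply bddD_scal, Lpow1_bdd);
      intros w Hw; unfold Lpow1; simpl; specialize (HM w Hw); apply Rabs_le_between in HM; lra. }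
  apply Rle_trans with (1 := H), Rmult_le_compat_l; auto.
  apply Rle_trans with (2 := HN z Hz), Rle_abs.
Qed.

Lemma iter_Lop_bdd k u : bddD u -> bddD (Nat.iter k L u).
Proof. intros Hu; induction k as [|k IH]; [exact Hu|now apply Lop_bdd]. Qed.

Lemma iter_Lop_nonneg k u : bddD u -> (forall z, Dset z -> 0 <= u z) ->
  forall z, Dset z -> 0 <= Nat.iter k L u z.
Proof.
  intros Hb Hu; induction k as [|k IH]; [exact Hu|].
  intros z Hz; apply Lop_nonneg; auto; now apply iter_Lop_bdd.
Qed.

Lemma iter_Lop_le k u w : bddD u -> bddD w -> (forall z, Dset z -> u z <= w z) ->
  forall z, Dset z -> Nat.iter k L u z <= Nat.iter k L w z.
Proof.
  intros Hu Hw H; induction k as [|k IH]; [exact H|].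
  intros z Hz; apply Lop_le; auto; now apply iter_Lop_bdd.
Qed.

Lemma iter_Lop_scal k u a : bddD u ->
  forall z, Dset z -> Nat.iter k L (fun z => a * u z) z = a * Nat.iter k L u z.
Proof.
  intros Hu; induction k as [|k IH]; [reflexivity|].
  intros z Hz; simpl; rewrite (Lop_ext _ _ z IH Hz), Lop_scal; auto; now apply iter_Lop_bdd.
Qed.

(** Bounds a and b on the ratio of successive iterates, in the order defined by the cone and not
    merely pointwise. For the best pair, ln (b / a) is Hilbert's projective distance of the two
    iterates. *)
Definition lowgap k a := fcone 4 (fun z => Lpow1 (S k) z - a * Lpow1 k z).
Definition upgap k b := fcone 4 (fun z => b * Lpow1 k z - Lpow1 (S k) z).

Lemma Lop_lowgap k a z : Dset z ->
  L (fun z => Lpow1 (S k) z - a * Lpow1 k z) z = Lpow1 (S (S k)) z - a * Lpow1 (S k) z.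
Proof.
  intros Hz.
  transitivity (L (fun z => 1 * Lpow1 (S k) z + (- a) * Lpow1 k z) z).
  - apply Lop_ext; auto; intros; ring.
  - rewrite Lop_comb; auto; try apply Lpow1_bdd.
    rewrite <- !Lpow1_S; ring.
Qed.

Lemma Lop_upgap k b z : Dset z ->
  L (fun z => b * Lpow1 k z - Lpow1 (S k) z) z = b * Lpow1 (S k) z - Lpow1 (S (S k)) z.
Proof.
  intros Hz.
  transitivity (L (fun z => (-1) * (Lpow1 (S k) z - b * Lpow1 k z)) z).
  - apply Lop_ext; auto; intros; ring.
  - rewrite Lop_scal, Lop_lowgap; auto; [ring|].
    destruct (bddD_comb _ _ 1 (-b) (Lpow1_bdd (S k)) (Lpow1_bdd k)) as [M HM].
    exists M; intros w Hw; specialize (HM w Hw).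
    replace (Lpow1 (S k) w - b * Lpow1 k w) with (1 * Lpow1 (S k) w + - b * Lpow1 k w) by ring; auto.
Qed.

Lemma lowgap_Lop k a : lowgap k a -> fcone 3 (fun z => Lpow1 (S (S k)) z - a * Lpow1 (S k) z).
Proof.
  intros H; apply fcone_ext with (2 := fcone_Lop _ H); intros; now apply Lop_lowgap.
Qed.

Lemma upgap_Lop k b : upgap k b -> fcone 3 (fun z => b * Lpow1 (S k) z - Lpow1 (S (S k)) z).
Proof.
  intros H; apply fcone_ext with (2 := fcone_Lop _ H); intros; now apply Lop_upgap.
Qed.

Lemma lowgap_le k n a : lowgap k a -> lowgap (n + k) a.
Proof.
  intros H; induction n as [|n IH]; auto; exact (fcone_weaken _ _ (lowgap_Lop _ _ IH)).
Qed.

Lemma upgap_le k n b : upgap k b -> upgap (n + k) b.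
Proof.
  intros H; induction n as [|n IH]; auto; exact (fcone_weaken _ _ (upgap_Lop _ _ IH)).
Qed.

(** Both gaps persist up to the common index k + j, where they are compared at the point 0. *)
Lemma gap_cross k j a b : lowgap k a -> upgap j b -> a <= b.
Proof.
  intros Ha Hb; apply (lowgap_le _ j) in Ha; apply (upgap_le _ k) in Hb.
  rewrite Nat.add_comm in Ha.
  assert (H1 := proj1 Ha _ Dset_0); assert (H2 := proj1 Hb _ Dset_0); simpl in H1, H2.
  pose proof (Lpow1_pos (k + j) 0 Dset_0).
  apply Rmult_le_reg_r with (Lpow1 (k + j) (RtoC 0)); lra.
Qed.

(** Two uses of [fcone_sub], with the roles of 1 and L 1 exchanged; the constants are the largest
    multiples that it permits. *)
Lemma gap_init : exists a b, 0 < a /\ lowgap 0 a /\ upgap 0 b.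
Proof.
  pose proof (Lpow1_pos 0 0 Dset_0) as P0; pose proof (Lpow1_pos 1 0 Dset_0) as P1.
  pose proof cc_bounds as Hc.
  set (t := cc * Lpow1 0 (RtoC 0) / Lpow1 1 (RtoC 0)).
  assert (Ht : 0 < t) by (apply Rdiv_lt_0_compat; auto; nra).
  exists (cc * Lpow1 1 (RtoC 0) / Lpow1 0 (RtoC 0)), (/ t); splits.
  - apply Rdiv_lt_0_compat; auto; nra.
  - apply fcone_sub; try apply Lpow1_cone.
    + left; apply Rdiv_lt_0_compat; auto; nra.
    + right; field; lra.
  - assert (H : fcone 4 (fun z => Lpow1 0 z - t * Lpow1 1 z)).
    { apply fcone_sub; try apply Lpow1_cone; [lra|right; unfold t; field; lra]. }
    apply fcone_ext with (fun z => / t * (Lpow1 0 z - t * Lpow1 1 z) + 0 * (Lpow1 0 z - t * Lpow1 1 z)).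
    + intros; field; lra.
    + apply fcone_comb; auto; [left; now apply Rinv_0_lt_compat|lra].
Qed.

(* Birkhoff's contraction: the images of the two gap functions add up to (b - a) Lpow1 (k+1),
   so one of them can absorb a fixed proportion of it. *)
Lemma gap_contract k a b : lowgap k a -> upgap k b ->
  exists a' b', lowgap (S k) a' /\ upgap (S k) b' /\ b' - a' = (1 - cc / 2) * (b - a).
Proof.
  intros Ha Hb; assert (Hab := gap_cross _ _ _ _ Ha Hb).
  pose proof cc_bounds as Hc.
  assert (Ha' := lowgap_Lop _ _ Ha); assert (Hb' := upgap_Lop _ _ Hb).
  set (t := cc / 2 * (b - a)); assert (Ht : 0 <= t) by (unfold t; nra).
  set (F1 := Lpow1 (S k) (RtoC 0)); set (F2 := Lpow1 (S (S k)) (RtoC 0)).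
  (* At 0 one of the two images is at least half of their sum (b - a) F1, and [fcone_sub] asks for
     nothing beyond the values at 0. This half is the 2 in t. *)
  destruct (Rle_dec ((b - a) / 2 * F1) (F2 - a * F1)) as [H|H].
  - exists (a + t), b; splits.
    + apply fcone_ext with (fun z => (Lpow1 (S (S k)) z - a * Lpow1 (S k) z) - t * Lpow1 (S k) z).
      * intros; ring.
      * apply fcone_sub; auto; [apply Lpow1_cone|]. fold F1 F2; unfold t; nra.
    + now apply (upgap_le k 1).
    + unfold t; lra.
  - exists a, (b - t); splits.
    + now apply (lowgap_le k 1).
    + apply fcone_ext with (fun z => (b * Lpow1 (S k) z - Lpow1 (S (S k)) z) - t * Lpow1 (S k) z).
      * intros; ring.
      * apply fcone_sub; auto; [apply Lpow1_cone|]. fold F1 F2; unfold t.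
        apply Rnot_le_lt in H; nra.
    + unfold t; lra.
Qed.

(** The supremum [lam] of all lower bounds lies between the k-th bounds a and b for every k, and b -
    a shrinks by the factor 1 - cc/2 at each step. *)
Lemma growth_rate : exists lam M g, 0 < lam /\ 0 < g < 1 /\ 0 <= M /\
  forall k z, Dset z -> Rabs (Lpow1 (S k) z - lam * Lpow1 k z) <= M * g ^ k * Lpow1 k z.
Proof.
  destruct gap_init as [a0 [b0 [Pa [Ha Hb]]]]; pose proof cc_bounds as Hc.
  destruct (completeness (fun a => exists k, lowgap k a)) as [lam [Hl1 Hl2]].
  - exists b0; intros a [k Hk]; now apply (gap_cross k 0).
  - now exists a0, O.
  - exists lam, (b0 - a0), (1 - cc / 2); splits; try lra.
    + apply Rlt_le_trans with (1 := Pa), Hl1; now exists O.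
    + assert (a0 <= b0) by now apply (gap_cross 0 0). lra.
    + intros k.
      assert (Hk : exists a b, lowgap k a /\ upgap k b /\ b - a = (1 - cc / 2) ^ k * (b0 - a0)).
      { induction k as [|k [a [b [Ga [Gb E]]]]].
        - exists a0, b0; splits; auto; ring.
        - destruct (gap_contract k a b Ga Gb) as [a' [b' [Ga' [Gb' E']]]].
          exists a', b'; splits; auto; rewrite E', E; simpl; ring. }
      destruct Hk as [a [b [Ga [Gb E]]]]; intros z Hz.
      assert (a <= lam) by (apply Hl1; now exists k).
      assert (lam <= b) by (apply Hl2; intros c [j Hj]; now apply (gap_cross j k)).
      assert (G1 := proj1 Ga z Hz); assert (G2 := proj1 Gb z Hz).
      pose proof (Lpow1_pos k z Hz); apply Rabs_le_between.
      rewrite (Rmult_comm (b0 - a0)), <- E; split; nra.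
Qed.

(** * Normalised iterates and their limit *)

Definition Lpow1n k z := Lpow1 k z / Lpow1 k (RtoC 0).

Lemma Lpow1n_cone k : fcone 3 (Lpow1n k).
Proof.
  pose proof (Lpow1_pos k 0 Dset_0).
  apply fcone_ext with (fun z => / Lpow1 k (RtoC 0) * Lpow1 k z + 0 * Lpow1 k z).
  - intros; unfold Lpow1n; field; lra.
  - apply fcone_comb; try apply Lpow1_cone; [left; now apply Rinv_0_lt_compat|lra].
Qed.

Lemma Lpow1n_0 k : Lpow1n k (RtoC 0) = 1.
Proof. pose proof (Lpow1_pos k 0 Dset_0); unfold Lpow1n; field; lra. Qed.

Lemma fcone_bounds u z : fcone 3 u -> u (RtoC 0) = 1 -> Dset z -> q0 ^ 3 <= u z <= / q0 ^ 3.
Proof.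
  intros Hu H1 Hz.
  assert (A1 := fcone_upper 3 u 0 z Hu Dset_0 Hz); assert (A2 := fcone_upper 3 u z 0 Hu Hz Dset_0).
  rewrite H1 in *; pose proof (pow_lt q0 3 (proj1 q0_bounds)); split; [lra|].
  apply Rmult_le_reg_l with (q0 ^ 3); auto; rewrite Rinv_r; lra.
Qed.

Lemma Lop_Lpow1n k z : Dset z -> L (Lpow1n k) z = Lpow1n (S k) z * (Lpow1 (S k) (RtoC 0) / Lpow1 k (RtoC 0)).
Proof.
  intros Hz; pose proof (Lpow1_pos k 0 Dset_0); pose proof (Lpow1_pos (S k) 0 Dset_0).
  transitivity (L (fun z => / Lpow1 k (RtoC 0) * Lpow1 k z) z).
  - apply Lop_ext; auto; intros; unfold Lpow1n; field; lra.
  - rewrite Lop_scal; auto; [|apply Lpow1_bdd].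
    rewrite <- Lpow1_S; unfold Lpow1n; field; lra.
Qed.

Lemma eigenvector : exists v lam M g, 0 < lam /\ 0 < g < 1 /\
  (forall k, Rabs (Lpow1 (S k) (RtoC 0) / Lpow1 k (RtoC 0) - lam) <= M * g ^ k) /\
  (forall k z, Dset z -> Rabs (Lpow1n k z - v z) <= M * g ^ k) /\
  fcone 3 v /\ v (RtoC 0) = 1 /\ forall z, Dset z -> L v z = lam * v z.
Proof.
  destruct growth_rate as [lam [M [g [Hl [Hg [HM H]]]]]].
  pose proof (pow_lt q0 3 (proj1 q0_bounds)) as Hq.
  assert (Hr : forall k, Rabs (Lpow1 (S k) (RtoC 0) / Lpow1 k (RtoC 0) - lam) <= M * g ^ k).
  { intros k; pose proof (Lpow1_pos k 0 Dset_0) as P; specialize (H k 0 Dset_0).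
    replace (Lpow1 (S k) (RtoC 0) / Lpow1 k (RtoC 0) - lam)
      with ((Lpow1 (S k) (RtoC 0) - lam * Lpow1 k (RtoC 0)) * / Lpow1 k (RtoC 0)) by (field; lra).
    rewrite Rabs_mult, (Rabs_right (/ _)) by (left; now apply Rinv_0_lt_compat).
    apply Rmult_le_reg_r with (1 := P); rewrite Rmult_assoc, Rinv_l, Rmult_1_r; lra. }
  (* With r the ratio of the iterates at 0, lam (h_(k+1) - h_k) = (h_(k+1) r - lam h_k) - h_(k+1) (r
     - lam). Each part is at most M g^k / q0^3, since the normalised iterates are at most 1 /
     q0^3. *)
  set (M' := 2 * M * / q0 ^ 3 / lam).
  assert (Hstep : forall z, Dset z -> forall k, Rabs (Lpow1n (S k) z - Lpow1n k z) <= M' * g ^ k).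
  { intros z Hz k.
    destruct (fcone_bounds _ z (Lpow1n_cone k) (Lpow1n_0 k) Hz) as [_ U0].
    destruct (fcone_bounds _ z (Lpow1n_cone (S k)) (Lpow1n_0 (S k)) Hz) as [_ U1].
    assert (P0 := proj1 (Lpow1n_cone k) z Hz); assert (P1 := proj1 (Lpow1n_cone (S k)) z Hz).
    pose proof (Lpow1_pos k 0 Dset_0) as P; pose proof (Lpow1_pos (S k) 0 Dset_0) as P'.
    set (r := Lpow1 (S k) (RtoC 0) / Lpow1 k (RtoC 0)) in *.
    assert (E1 : Rabs (Lpow1n (S k) z * r - lam * Lpow1n k z) <= M * g ^ k * Lpow1n k z).
    { specialize (H k z Hz).
      replace (Lpow1n (S k) z * r - lam * Lpow1n k z)
        with ((Lpow1 (S k) z - lam * Lpow1 k z) * / Lpow1 k (RtoC 0)) by (unfold Lpow1n, r; field; lra).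
      rewrite Rabs_mult, (Rabs_right (/ _)) by (left; now apply Rinv_0_lt_compat).
      unfold Lpow1n, Rdiv; rewrite <- Rmult_assoc; apply Rmult_le_compat_r; auto.
      left; now apply Rinv_0_lt_compat. }
    specialize (Hr k); fold r in Hr.
    assert (Hgk : 0 <= M * g ^ k) by (apply Rmult_le_pos; auto; apply pow_le; lra).
    apply Rmult_le_reg_l with (1 := Hl).
    replace (lam * (M' * g ^ k)) with (M * g ^ k * / q0 ^ 3 + / q0 ^ 3 * (M * g ^ k))
      by (unfold M'; set (y := / q0 ^ 3); field; lra).
    rewrite <- (Rabs_right lam) at 1 by lra; rewrite <- Rabs_mult.
    replace (lam * (Lpow1n (S k) z - Lpow1n k z))
      with ((Lpow1n (S k) z * r - lam * Lpow1n k z) + - (Lpow1n (S k) z * (r - lam))) by ring.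
    eapply Rle_trans; [apply Rabs_triang|]; rewrite Rabs_Ropp, (Rabs_mult (Lpow1n (S k) z)),
      (Rabs_pos_eq _ P1).
    apply Rplus_le_compat.
    - apply Rle_trans with (1 := E1); apply Rmult_le_compat_l; auto.
    - apply Rmult_le_compat; auto; apply Rabs_pos. }
  set (v := fun z => real (Lim_seq (fun k => Lpow1n k z))).
  assert (Hlim : forall z, Dset z -> forall k, Rabs (Lpow1n k z - v z) <= M' / (1 - g) * g ^ k).
  { unfold v; intros z Hz; destruct (geometric_cauchy _ _ _ Hg (Hstep z Hz)) as [l Hlz].
    assert (E := is_lim_seq_unique _ _ (geometric_lim _ _ _ _ Hg Hlz)); rewrite E; auto. }
  assert (Hlim' : forall z, Dset z -> is_lim_seq (fun k => Lpow1n k z) (v z)).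
  { intros z Hz; exact (geometric_lim _ _ _ _ Hg (Hlim z Hz)). }
  assert (Hv : fcone 3 v).
  { split.
    - intros z Hz; apply (is_lim_seq_le (fun _ => 0) (fun k => Lpow1n k z) 0 (v z)); auto.
      + intros k; now apply Lpow1n_cone.
      + apply is_lim_seq_const.
    - intros z w Hz Hw.
      apply (is_lim_seq_le (fun k => q z w ^ 3 * Lpow1n k z) (fun k => Lpow1n k w)
               (q z w ^ 3 * v z) (v w)); auto.
      + intros k; now apply Lpow1n_cone.
      + exact (is_lim_seq_scal_l _ (q z w ^ 3) (v z) (Hlim' z Hz)). }
  set (M2 := Rmax M (M' / (1 - g))).
  assert (Hgp : forall k, 0 <= g ^ k) by (intros; apply pow_le; lra).
  exists v, lam, M2, g; splits; try tauto.
  - intros k; apply Rle_trans with (1 := Hr k), Rmult_le_compat_r; auto; apply Rmax_l.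
  - intros k z Hz; apply Rle_trans with (1 := Hlim z Hz k), Rmult_le_compat_r; auto; apply Rmax_r.
  - assert (E := is_lim_seq_unique _ _ (Hlim' _ Dset_0)).
    rewrite (Lim_seq_ext _ (fun _ => 1)), Lim_seq_const in E by (intros; apply Lpow1n_0).
    now injection E.
  - intros z Hz.
    assert (H1 : is_lim_seq (fun k => L (Lpow1n k) z) (lam * v z)).
    { apply is_lim_seq_ext with (fun k => Lpow1n (S k) z * (Lpow1 (S k) (RtoC 0) / Lpow1 k (RtoC 0))).
      - intros k; symmetry; now apply Lop_Lpow1n.
      - rewrite (Rmult_comm lam); apply is_lim_seq_mult'.
        + apply (is_lim_seq_incr_1 (fun k => Lpow1n k z)), Hlim', Hz.
        + exact (geometric_lim _ _ _ _ Hg Hr). }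
    (* No exchange of limit and series: by monotonicity, functions within e of each other on D have
       images within e L 1. *)
    assert (H2 : is_lim_seq (fun k => L (Lpow1n k) z) (L v z)).
    { apply geometric_lim with (M := M' / (1 - g) * Lpow1 1 z) (g := g); auto; intros k.
      set (e := M' / (1 - g) * g ^ k).
      assert (Hb := fcone_bdd _ _ Hv); assert (Hbk := fcone_bdd _ _ (Lpow1n_cone k)).
      assert (U : forall a u w, fcone 3 u -> fcone 3 w ->
        (forall x, Dset x -> u x <= w x + a) -> L u z <= L w z + a * Lpow1 1 z).
      { intros a u w Hu Hw Huw; apply Rle_trans with (L (fun x => 1 * w x + a * Lpow1 0 x) z).
        - apply Lop_le; auto; [now apply fcone_bdd with 3%nat| |].
          + apply bddD_comb; [now apply fcone_bdd with 3%nat|apply Lpow1_bdd].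
          + intros x Hx; unfold Lpow1; simpl; specialize (Huw x Hx); lra.
        - rewrite Lop_comb; auto; [|now apply fcone_bdd with 3%nat|apply Lpow1_bdd].
          rewrite <- Lpow1_S; lra. }
      assert (U1 := U e v (Lpow1n k) Hv (Lpow1n_cone k)).
      assert (U2 := U e (Lpow1n k) v (Lpow1n_cone k) Hv).
      assert (A : forall x, Dset x -> v x <= Lpow1n k x + e /\ Lpow1n k x <= v x + e).
      { intros x Hx; specialize (Hlim x Hx k); fold e in Hlim.
        apply Rabs_le_between in Hlim; lra. }
      specialize (U1 (fun x Hx => proj1 (A x Hx))); specialize (U2 (fun x Hx => proj2 (A x Hx))).
      replace (M' / (1 - g) * Lpow1 1 z * g ^ k) with (e * Lpow1 1 z) by (unfold e; ring).
      apply Rabs_le_between; lra. }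
    apply is_lim_seq_unique in H1; apply is_lim_seq_unique in H2; congruence.
Qed.

End Operator.

(** * Spectral radius *)

(** If y < x, then a <= b (y/x)^k tends to 0, against a > 0. *)
Lemma pow_dominated_le a b x y : 0 < a -> 0 < x -> 0 < y ->
  (forall k, a * x ^ k <= b * y ^ k) -> x <= y.
Proof.
  intros Ha Hx Hy H; apply Rnot_lt_le; intros Hlt.
  assert (Hq : 0 < y / x < 1).
  { split; [now apply Rdiv_lt_0_compat|apply Rlt_div_l; lra]. }
  assert (Hl : is_lim_seq (fun k => b * (y / x) ^ k) (b * 0)).
  { apply (is_lim_seq_scal_l _ b 0), is_lim_seq_geom; rewrite Rabs_right; lra. }
  enough (Hk : forall k, a <= b * (y / x) ^ k).
  { assert (Hle := is_lim_seq_le (fun _ => a) _ a _ Hk (is_lim_seq_const a) Hl).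
    simpl in Hle; lra. }
  intros k; specialize (H k); unfold Rdiv; rewrite Rpow_mult_distr, pow_inv.
  pose proof (pow_lt x k Hx); apply Rmult_le_reg_r with (x ^ k); auto.
  replace (b * (y ^ k * / x ^ k) * x ^ k) with (b * y ^ k) by (field; lra); auto.
Qed.

Lemma nroot_lim (x : nat -> R) a b lam : 0 < a -> 0 < lam ->
  (forall k, a * lam ^ k <= x k <= b * lam ^ k) -> is_lim_seq (fun k => nroot k (x k)) lam.
Proof.
  (* The shift discards k = 0, where the root of order k has no meaning. *)
  intros Ha Hl H; apply is_lim_seq_incr_1.
  assert (Hp : forall k, 0 < a * lam ^ k) by (intros k; pose proof (pow_lt lam k Hl); nra).
  assert (Hb : 0 < b) by (specialize (H O); simpl in H; lra).
  apply is_lim_seq_ext with (fun k => exp (/ INR (S k) * ln (x (S k)))).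
  { intros k; unfold nroot; destruct (Rle_dec _ _) as [Hx|Hx]; auto.
    specialize (H (S k)); specialize (Hp (S k)); lra. }
  rewrite <- (exp_ln lam Hl) at 1.
  apply (is_lim_seq_continuous exp).
  { apply derivable_continuous_pt, derivable_pt_exp. }
  assert (Hinv : forall c, is_lim_seq (fun k => / INR (S k) * c + ln lam) (ln lam)).
  { intros c; replace (Finite (ln lam)) with (Finite (0 * c + ln lam)) by (f_equal; ring).
    apply is_lim_seq_plus'; [|apply is_lim_seq_const].
    apply is_lim_seq_mult'; [|apply is_lim_seq_const].
    apply (is_lim_seq_incr_1 (fun k => / INR k)).
    replace (Finite 0) with (Rbar_inv p_infty) by reflexivity.
    apply is_lim_seq_inv; [apply is_lim_seq_INR|discriminate]. }
  assert (Hln : forall c k, 0 < c -> / INR (S k) * ln c + ln lam = / INR (S k) * ln (c * lam ^ S k)).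
  { intros c k Hc; rewrite ln_mult by (auto; now apply pow_lt).
    rewrite ln_pow by auto; field; apply not_0_INR; lia. }
  apply is_lim_seq_le_le with (fun k => / INR (S k) * ln a + ln lam)
    (fun k => / INR (S k) * ln b + ln lam); auto.
  intros k; rewrite !Hln by auto; specialize (H (S k)); specialize (Hp (S k)).
  assert (0 < / INR (S k)) by (apply Rinv_0_lt_compat, lt_0_INR; lia).
  split; (apply Rmult_le_compat_l; [lra|]; apply ln_le; lra).
Qed.

Section Eigen.
Context (B : C -> Prop) (HB : forall b, B b -> I1 b) (B0 : exists b, B b).
Context (s : R) (Hs : 0 < s).
Context (HW : forall z, Dset z -> summable B (fun b => wt s b z)).

Local Notation L := (Lop B s).
Local Notation q := (qd s).
Local Notation q0 := (exp (- (4 * s))).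
Local Notation fk := (Lpow1 B s).
Local Notation bdd3 u := (fcone_bdd s Hs 3 u).

Lemma Dlip_bdd (u : C -> R) : lipschitz_onD u -> bddD u.
Proof.
  intros [K HK]; exists (Rabs K + Rabs (u (RtoC 0))); intros z Hz.
  replace (u z) with ((u z - u (RtoC 0)) + u (RtoC 0)) by ring.
  eapply Rle_trans; [apply Rabs_triang|]; apply Rplus_le_compat_r.
  apply Rle_trans with (1 := HK _ _ Hz Dset_0).
  pose proof (Dset_dist z 0 Hz Dset_0); pose proof (Cmod_ge_0 (z - 0)).
  pose proof (Rle_abs K); pose proof (Rabs_pos K); nra.
Qed.

Lemma Dlip_dH (u : C -> R) : lipschitz_onD u -> exists K, 0 <= K /\
  forall z w, Dset z -> Dset w -> Rabs (u z - u w) <= K * dH z w.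
Proof.
  intros [K HK]; exists (2 * Rabs K); split; [pose proof (Rabs_pos K); lra|].
  intros z w Hz Hw; apply Rle_trans with (1 := HK _ _ Hz Hw).
  pose proof (Cmod_le_dH z w Hz Hw); pose proof (Cmod_ge_0 (z - w)).
  pose proof (Rle_abs K); pose proof (Rabs_pos K); nra.
Qed.

(** From 1 - e^(-x) <= x and the boundedness of u. *)
Lemma fcone_lipschitz n u : fcone s n u -> lipschitz_onD u.
Proof.
  intros Hu; destruct (fcone_bdd s Hs n u Hu) as [M HM].
  assert (HM0 : 0 <= M) by (eapply Rle_trans; [apply Rabs_pos|apply (HM _ Dset_0)]).
  exists (M * (INR n * (4 * s))).
  assert (A : forall z w, Dset z -> Dset w -> u z - u w <= M * (INR n * (4 * s)) * Cmod (z - w)).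
  { intros z w Hz Hw; assert (H1 := proj2 Hu z w Hz Hw); assert (H0 := proj1 Hu z Hz).
    specialize (HM z Hz); rewrite Rabs_pos_eq in HM by auto.
    assert (H2 : 1 - q z w ^ n <= INR n * (4 * s) * Cmod (z - w)).
    { pose proof (dH_le_Cmod z w (proj1 (Dset_re _ Hz)) (proj1 (Dset_re _ Hw))).
      assert (q z w ^ n = exp (- (INR n * (4 * s) * dH z w))) as ->.
      { unfold qd; rewrite <- Rpower_pow by apply exp_pos.
        unfold Rpower; rewrite ln_exp; f_equal; ring. }
      pose proof (exp_ineq1_le (- (INR n * (4 * s) * dH z w))).
      assert (0 <= INR n * (4 * s)) by (apply Rmult_le_pos; [apply pos_INR|lra]).
      apply Rle_trans with (INR n * (4 * s) * dH z w); [lra|].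
      now apply Rmult_le_compat_l. }
    apply Rle_trans with ((1 - q z w ^ n) * u z); [lra|].
    assert (0 <= 1 - q z w ^ n).
    { assert (q z w ^ n <= 1); [|lra]. rewrite <- (pow1 n); apply pow_incr.
      split; [left; apply qd_pos|now apply qd_le1]. }
    rewrite Rmult_assoc, (Rmult_comm M); apply Rmult_le_compat; auto. }
  intros z w Hz Hw; apply Rabs_le; split; [|now apply A].
  assert (H := A w z Hw Hz).
  replace (Cmod (z - w)) with (Cmod (w - z)); [lra|].
  rewrite <- Cmod_opp; f_equal; ring.
Qed.

(** Positivity of L reduces the operator norm to the iterates of the constant 1. *)
Lemma iter_Lop_bound k u : bddD u -> (forall z, Dset z -> Rabs (u z) <= 1) ->
  forall z, Dset z -> Rabs (Nat.iter k L u z) <= fk k z.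
Proof.
  intros Hb Hu z Hz.
  assert (B1 := bddD_const 1).
  apply Rabs_le; split.
  - replace (- fk k z) with ((-1) * Nat.iter k L (fun _ => 1) z) by (unfold Lpow1; ring).
    rewrite <- (iter_Lop_scal B HB B0 s Hs HW) by auto.
    apply iter_Lop_le; auto; [now apply bddD_scal|].
    intros w Hw; specialize (Hu w Hw); apply Rabs_le_between in Hu; lra.
  - apply iter_Lop_le; auto; intros w Hw; apply Rle_trans with (2 := Hu w Hw), Rle_abs.
Qed.

(** An estimate of Lasota-Yorke type for functions outside the cones. The exponent 2 is the fixed
    point of n -> 1 + n/2, so it is reproduced at each step, while the additive error is halved with
    the distance. *)
Lemma iter_Lop_osc k g K : (forall z, Dset z -> 0 <= g z) -> bddD g -> 0 <= K ->
  (forall z w, Dset z -> Dset w -> Rabs (g z - g w) <= K * dH z w) ->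
  forall z w, Dset z -> Dset w ->
    q z w ^ 2 * Nat.iter k L g z <= Nat.iter k L g w + K * (/ 2) ^ k * dH z w * fk k w.
Proof.
  intros Hg Hb HK HL; induction k as [|k I3]; intros z w Hz Hw.
  - simpl; unfold Lpow1; simpl.
    specialize (HL z w Hz Hw); apply Rabs_le_between in HL; specialize (Hg z Hz).
    pose proof (qd_pos s z w); pose proof (qd_le1 s Hs z w Hz Hw).
    assert (q z w * (q z w * 1) * g z <= 1 * g z) by (apply Rmult_le_compat_r; auto; nra).
    lra.
  - assert (I1 := iter_Lop_nonneg B HB B0 s Hs HW k g Hb Hg).
    assert (I2 := iter_Lop_bdd B HB B0 s Hs HW k g Hb).
    set (G := Nat.iter k L g) in *.
    simpl Nat.iter; fold G.
    set (e := K * (/ 2) ^ S k * dH z w).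
    assert (Bf := Lpow1_bdd B HB B0 s Hs HW k).
    apply Rle_trans with (L (fun x => 1 * G x + e * fk k x) w).
    2:{ rewrite (Lop_comb B HB s HW) by auto; rewrite <- Lpow1_S; lra. }
    rewrite !LopE, <- sumB_scal by now apply Lop_summable.
    apply sumB_le.
    + destruct (Lop_summable B HB s HW G z I2 Hz) as [l Hl].
      eexists; apply has_sum_scal, Hl.
    + apply (Lop_summable B HB s HW (fun x => 1 * G x + e * fk k x)); auto.
      now apply bddD_comb.
    + intros b Hbb; assert (Hb1 := B_re B HB b Hbb).
      assert (Tz := B_theta B HB b z Hbb Hz); assert (Tw := B_theta B HB b w Hbb Hw).
      specialize (I3 _ _ Tz Tw); assert (Gz := I1 _ Tz).
      assert (H1 := wt_qd s Hs b z w Hb1 Hz Hw).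
      assert (H2 := qd_theta s Hs b z w Hb1 Hz Hw).
      pose proof (qd_pos s z w); pose proof (wt_pos s b z).
      assert (H3 := dH_theta b z w Hb1 (proj1 (Dset_re _ Hz)) (proj1 (Dset_re _ Hw))).
      assert (Fw := Lpow1_pos B HB B0 s Hs HW k _ Tw).
      replace (q z w ^ 2 * (wt s b z * G (theta b z)))
        with ((q z w * wt s b z) * (q z w * G (theta b z))) by ring.
      apply Rmult_le_compat; auto; [nra|nra|].
      apply Rle_trans with (qd s (theta b z) (theta b w) ^ 2 * G (theta b z)).
      { apply Rmult_le_compat_r; auto. }
      apply Rle_trans with (1 := I3); rewrite Rmult_1_l; apply Rplus_le_compat_l.
      apply Rmult_le_compat_r; [lra|]; unfold e; simpl pow.
      assert (0 <= K * (/ 2) ^ k) by (apply Rmult_le_pos; auto; apply pow_le; lra). nra.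
Qed.

Context (v : C -> R) (lam : R) (Hl : 0 < lam) (Hv : fcone s 3 v) (Hv1 : v (RtoC 0) = 1).
Context (Hev : forall z, Dset z -> L v z = lam * v z).

Lemma v_bounds z : Dset z -> q0 ^ 3 <= v z <= / q0 ^ 3.
Proof. intros; now apply fcone_bounds. Qed.

(** The constant 1 lies between [q0 ^ 3] v and v / [q0 ^ 3], and L^k multiplies v by lam^k; bounding
    v itself costs [q0 ^ 3] once more. *)
Lemma Lpow1_growth k z : Dset z -> q0 ^ 6 * lam ^ k <= fk k z <= / q0 ^ 6 * lam ^ k.
Proof.
  pose proof (pow_lt q0 3 (exp_pos _)) as Hq.
  assert (Bv := bdd3 v Hv).
  assert (H : forall k z, Dset z ->
            q0 ^ 3 * lam ^ k * v z <= fk k z <= / q0 ^ 3 * lam ^ k * v z).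
  { clear k z; induction k as [|k IH]; intros z Hz.
    - unfold Lpow1; simpl Nat.iter; simpl (lam ^ 0); rewrite !Rmult_1_r.
      destruct (v_bounds z Hz) as [H1 H2]; set (c := q0 ^ 3) in *; split.
      + apply Rmult_le_reg_l with (/ c); [now apply Rinv_0_lt_compat|].
        rewrite <- Rmult_assoc, Rinv_l by lra; lra.
      + apply Rmult_le_reg_l with c; auto; rewrite <- Rmult_assoc, Rinv_r by lra; lra.
    - rewrite Lpow1_S; assert (Bf := Lpow1_bdd B HB B0 s Hs HW k).
      assert (Bc : forall c, bddD (fun z => c * v z)) by (intros; now apply bddD_scal).
      assert (E : forall c, c * lam ^ S k * v z = L (fun z => (c * lam ^ k) * v z) z).
      { intros c; rewrite (Lop_scal B HB s HW), Hev by auto; simpl; ring. }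
      rewrite !E; split; apply Lop_le; auto; apply IH. }
  intros Hz; destruct (H k z Hz) as [H1 H2], (v_bounds z Hz) as [V1 V2].
  pose proof (pow_lt lam k Hl) as Hlk.
  pose proof (Rinv_0_lt_compat _ Hq).
  split.
  - apply Rle_trans with (2 := H1).
    replace (q0 ^ 6 * lam ^ k) with (q0 ^ 3 * lam ^ k * q0 ^ 3) by ring.
    apply Rmult_le_compat_l; auto; nra.
  - apply Rle_trans with (1 := H2).
    replace (/ q0 ^ 6 * lam ^ k) with (/ q0 ^ 3 * lam ^ k * / q0 ^ 3)
      by (replace (q0 ^ 6) with (q0 ^ 3 * q0 ^ 3) by ring; rewrite Rinv_mult; ring).
    apply Rmult_le_compat_l; auto; nra.
Qed.

Lemma opnorm_growth k :
  q0 ^ 6 * lam ^ k <= opnorm (Nat.iter k L) <= / q0 ^ 6 * lam ^ k.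
Proof.
  unfold opnorm; set (E := fun r : R => _).
  destruct (Lub_Rbar_correct E) as [Hub Hlub].
  assert (Hup : Rbar_le (Lub_Rbar E) (/ q0 ^ 6 * lam ^ k)).
  { apply Hlub; intros r [u [Hc [Hu [z [Hz ->]]]]]; simpl.
    apply Rle_trans with (2 := proj2 (Lpow1_growth k z Hz)).
    apply iter_Lop_bound; auto; now exists 1. }
  assert (Hlo : Rbar_le (fk k (RtoC 0)) (Lub_Rbar E)).
  { apply Hub; exists (fun _ => 1); split; [|split].
    - intros z Hz eps He; exists 1; split; [lra|]; intros w _ _.
      unfold Rminus; rewrite Rplus_opp_r, Rabs_R0; lra.
    - intros z _; rewrite Rabs_R1; lra.
    - exists (RtoC 0); split; [apply Dset_0|].
      symmetry; apply Rabs_pos_eq; left; apply (Lpow1_pos B HB B0 s Hs HW k _ Dset_0). }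
  pose proof (Lpow1_growth k 0 Dset_0).
  (* The two bounds exclude an infinite supremum, which [real] would send to 0. *)
  destruct (Lub_Rbar E) as [l| |]; simpl in *; try contradiction; lra.
Qed.

Lemma spectral_radius : is_lim_seq (fun k => nroot k (opnorm (Nat.iter k L))) lam.
Proof.
  apply nroot_lim with (q0 ^ 6) (/ q0 ^ 6); auto; [apply pow_lt, exp_pos|apply opnorm_growth].
Qed.

Lemma iter_eigen w mu k : bddD w -> (forall z, Dset z -> L w z = mu * w z) ->
  forall z, Dset z -> Nat.iter k L w z = mu ^ k * w z.
Proof.
  intros Hb He; induction k as [|k IH]; intros z Hz; simpl; [ring|].
  rewrite (Lop_ext B HB s _ (fun z => mu ^ k * w z)) by auto.
  rewrite (Lop_scal B HB s HW), He by auto; ring.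
Qed.

End Eigen.

(** * Uniqueness and conjugation symmetry *)

Lemma Dset_lim (z : nat -> C) x y M : (forall k, Dset (z k)) ->
  (forall k, Rabs (fst (z k) - x) <= M * (/ 2) ^ k) ->
  (forall k, Rabs (snd (z k) - y) <= M * (/ 2) ^ k) -> Dset (x, y).
Proof.
  intros Hz Hx Hy; apply Dset_iff; simpl.
  apply geometric_lim in Hx; [|lra]; apply geometric_lim in Hy; [|lra].
  apply (is_lim_seq_le (fun k => fst (z k) * fst (z k) + snd (z k) * snd (z k))
           (fun k => fst (z k)) (x * x + y * y) x); auto.
  - intros k; now apply Dset_iff.
  - apply is_lim_seq_plus'; now apply is_lim_seq_mult'.
Qed.

Lemma Cmod_le_parts (z : C) : Cmod z <= Rabs (fst z) + Rabs (snd z).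
Proof.
  apply Rsqr_incr_0_var; [|apply Rplus_le_le_0_compat; apply Rabs_pos].
  unfold Rsqr; rewrite Cmod_sqr.
  pose proof (Rabs_pos (fst z)); pose proof (Rabs_pos (snd z)).
  assert (forall x, x * x = Rabs x * Rabs x) as E.
  { intros x; rewrite <- Rabs_mult, Rabs_pos_eq; nra. }
  rewrite (E (fst z)), (E (snd z)); nra.
Qed.

Lemma pow_half_small M e : 0 < e -> exists k, M * (/ 2) ^ k < e.
Proof.
  intros He.
  destruct (pow_lt_1_zero (/ 2) ltac:(rewrite Rabs_pos_eq; lra) (e / (Rabs M + 1))) as [k Hk].
  { apply Rdiv_lt_0_compat; auto; pose proof (Rabs_pos M); lra. }
  exists k; specialize (Hk k (Nat.le_refl k)); rewrite Rabs_pos_eq in Hk by (apply pow_le; lra).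
  pose proof (Rabs_pos M); pose proof (Rle_abs M); pose proof (pow_lt (/ 2) k ltac:(lra)).
  apply Rlt_div_r in Hk; [|lra]. nra.
Qed.

(** * Orbits of a single map *)

Section Orbit.
Context (b : C) (Hb : 1 <= fst b).

Definition orbit k z := Nat.iter k (theta b) z.

Lemma orbit_D k z : Dset z -> Dset (orbit k z).
Proof.
  intros Hz; induction k as [|k IH]; [exact Hz|].
  apply theta_D; auto; now apply Dset_re.
Qed.

Lemma orbit_dH k z w : Dset z -> Dset w -> dH (orbit k z) (orbit k w) <= (/ 2) ^ k.
Proof.
  intros Hz Hw; induction k as [|k IH]; [now apply dH_le1|].
  assert (H := dH_theta b _ _ Hb (proj1 (Dset_re _ (orbit_D k z Hz)))
                 (proj1 (Dset_re _ (orbit_D k w Hw)))).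
  simpl in *; lra.
Qed.

Lemma orbit_Cmod k z w : Dset z -> Dset w -> Cmod (orbit k z - orbit k w) <= 2 * (/ 2) ^ k.
Proof.
  intros Hz Hw; pose proof (orbit_dH k z w Hz Hw).
  pose proof (Cmod_le_dH _ _ (orbit_D k z Hz) (orbit_D k w Hw)); lra.
Qed.

(** The limit p is that of the orbit of 0. In the constant 10, 2 compares an orbit with that of 0,
    and each coordinate of the latter contributes the geometric sum 4. *)
Lemma orbit_limit : exists p, Dset p /\
  forall k z, Dset z -> Cmod (orbit k z - p) <= 10 * (/ 2) ^ k.
Proof.
  set (u := fun k => orbit k (RtoC 0)).
  assert (Hu : forall k, Dset (u k)) by (intros; apply orbit_D, Dset_0).
  assert (Hstep : forall k, Cmod (u (S k) - u k) <= 2 * (/ 2) ^ k).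
  { intros k; unfold u, orbit; rewrite Nat.iter_succ_r; apply orbit_Cmod; [|apply Dset_0].
    apply theta_D; auto; simpl; lra. }
  destruct (geometric_cauchy (fun k => fst (u k)) 2 (/ 2) ltac:(lra)) as [x Hx].
  { intros k; eapply Rle_trans; [|apply Hstep].
    eapply Rle_trans; [|apply (Rmax_Cmod (u (S k) - u k)%C)]; apply Rmax_l. }
  destruct (geometric_cauchy (fun k => snd (u k)) 2 (/ 2) ltac:(lra)) as [y Hy].
  { intros k; eapply Rle_trans; [|apply Hstep].
    eapply Rle_trans; [|apply (Rmax_Cmod (u (S k) - u k)%C)]; apply Rmax_r. }
  exists (x, y); split; [exact (Dset_lim u x y _ Hu Hx Hy)|].
  intros k z Hz; specialize (Hx k); specialize (Hy k).
  assert (H1 := orbit_Cmod k z 0 Hz Dset_0); fold (u k) in H1.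
  replace (orbit k z - (x, y))%C with ((orbit k z - u k) + (u k - (x, y)))%C by ring.
  eapply Rle_trans; [apply Cmod_triangle|].
  assert (H2 := Cmod_le_parts (u k - (x, y))%C); simpl fst in H2; simpl snd in H2.
  replace (2 / (1 - / 2)) with 4 in Hx, Hy by field.
  unfold Rminus in *; lra.
Qed.

End Orbit.

Section Uniqueness.
Context (B : C -> Prop) (HB : forall b, B b -> I1 b) (B0 : exists b, B b).
Context (s : R) (Hs : 0 < s).
Context (HW : forall z, Dset z -> summable B (fun b => wt s b z)).

Local Notation L := (Lop B s).
Local Notation q0 := (exp (- (4 * s))).

(* Each L w (z) dominates the term of a single b, and the orbits of theta_b converge uniformly
   to a point where w is positive. *)
Lemma eigenvector_bounded_below w mu : (forall z, Dset z -> 0 < w z) -> lipschitz_onD w ->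
  (forall z, Dset z -> L w z = mu * w z) ->
  0 < mu /\ exists d, 0 < d /\ forall z, Dset z -> d <= w z.
Proof.
  intros Hw HL He; assert (Hbd := Dlip_bdd w HL); destruct B0 as [b Hbb].
  assert (Hb := B_re B HB b Hbb).
  assert (Hge : forall z, Dset z -> wt s b z * w (theta b z) <= mu * w z).
  { intros z Hz; rewrite <- He by auto; apply (Lop_ge_term B HB s HW); auto.
    intros x Hx; left; auto. }
  assert (Hmu : 0 < mu).
  { specialize (Hge 0 Dset_0); specialize (Hw 0 Dset_0) as W0.
    assert (W1 := Hw _ (B_theta B HB b 0 Hbb Dset_0)); pose proof (wt_pos s b 0).
    apply Rmult_lt_reg_r with (w (RtoC 0)); auto; nra. }
  split; auto.
  (* A lower bound for the weight of b on all of D. *)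
  set (om := q0 * wt s b (RtoC 0)).
  assert (Hom : 0 < om) by (apply Rmult_lt_0_compat; [apply exp_pos|apply wt_pos]).
  assert (Hge' : forall k z, Dset z -> om ^ k * w (orbit b k z) <= mu ^ k * w z).
  { induction k as [|k IH]; intros z Hz; [simpl; lra|].
    assert (H1 := Hge _ (orbit_D b Hb k z Hz)); specialize (IH z Hz).
    assert (H2 : om <= wt s b (orbit b k z)).
    { apply Rle_trans with (2 := wt_qd s Hs b 0 _ Hb Dset_0 (orbit_D b Hb k z Hz)).
      apply Rmult_le_compat_r; [left; apply wt_pos|].
      apply qd_ge; auto; [apply Dset_0|now apply orbit_D]. }
    change (orbit b (S k) z) with (theta b (orbit b k z)).
    assert (W1 := Hw _ (B_theta B HB b _ Hbb (orbit_D b Hb k z Hz))).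
    pose proof (pow_lt om k Hom).
    simpl pow; apply Rle_trans with (om ^ k * (mu * w (orbit b k z))).
    - rewrite (Rmult_comm om), Rmult_assoc; apply Rmult_le_compat_l; [lra|].
      apply Rle_trans with (2 := H1), Rmult_le_compat_r; lra.
    - nra. }
  destruct (orbit_limit b Hb) as [p [Hp Hlim]], HL as [K HK].
  assert (Wp := Hw p Hp).
  (* After k steps every orbit is so close to p that w there is at least half of w p; this k serves
     all starting points. *)
  destruct (pow_half_small (Rabs K * 10) (w p / 2) ltac:(lra)) as [k Hk].
  exists ((om / mu) ^ k * (w p / 2)); split.
  { apply Rmult_lt_0_compat; [apply pow_lt, Rdiv_lt_0_compat; auto|lra]. }
  intros z Hz; specialize (Hge' k z Hz); specialize (Hlim k z Hz).
  assert (Ho := orbit_D b Hb k z Hz).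
  assert (H1 : w p / 2 <= w (orbit b k z)).
  { specialize (HK _ _ Ho Hp); apply Rabs_le_between in HK.
    pose proof (Cmod_ge_0 (orbit b k z - p)); pose proof (Rle_abs K); pose proof (Rabs_pos K).
    assert (K * Cmod (orbit b k z - p) <= Rabs K * (10 * (/ 2) ^ k)); [|lra].
    apply Rle_trans with (Rabs K * Cmod (orbit b k z - p)).
    - apply Rmult_le_compat_r; auto.
    - apply Rmult_le_compat_l; auto. }
  pose proof (pow_lt om k Hom); pose proof (pow_lt mu k Hmu).
  unfold Rdiv at 1; rewrite Rpow_mult_distr, pow_inv.
  apply Rmult_le_reg_l with (mu ^ k); auto.
  replace (mu ^ k * (om ^ k * / mu ^ k * (w p / 2))) with (om ^ k * (w p / 2)) by (field; lra).
  apply Rle_trans with (2 := Hge'), Rmult_le_compat_l; lra.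
Qed.

Context (v : C -> R) (lam : R) (Hl : 0 < lam) (Hv : fcone s 3 v) (Hv1 : v (RtoC 0) = 1).
Context (Hev : forall z, Dset z -> L v z = lam * v z).

Local Notation growth := (Lpow1_growth B HB B0 s Hs HW v lam Hl Hv Hv1 Hev).

(** From d <= w <= M and positivity, d L^k 1 <= mu^k w <= M L^k 1, while L^k 1 is comparable to
    lam^k. *)
Lemma eigenvalue_unique w mu : (forall z, Dset z -> 0 < w z) -> lipschitz_onD w ->
  (forall z, Dset z -> L w z = mu * w z) -> mu = lam.
Proof.
  intros Hw HL He; destruct (eigenvector_bounded_below w mu Hw HL He) as [Hmu [d [Hd Hlow]]].
  assert (Hbd := Dlip_bdd w HL); destruct Hbd as [M HM].
  assert (Hbd : bddD w) by now exists M.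
  assert (HMw : forall z, Dset z -> w z <= M)
    by (intros z Hz; apply Rle_trans with (2 := HM z Hz), Rle_abs).
  pose proof (pow_lt q0 6 (exp_pos _)) as Hq.
  assert (HM0 : 0 < M) by (specialize (Hw _ Dset_0); specialize (HMw _ Dset_0); lra).
  assert (W0 := Hw _ Dset_0); assert (HM1 := HMw _ Dset_0).
  assert (Hscal : forall c k, Nat.iter k L (fun _ => c) (RtoC 0) = c * Lpow1 B s k (RtoC 0)).
  { intros c k; transitivity (Nat.iter k L (fun z => c * 1) (RtoC 0)); [now rewrite Rmult_1_r|].
    apply (iter_Lop_scal B HB B0 s Hs HW k (fun _ => 1)); [apply bddD_const|apply Dset_0]. }
  apply Rle_antisym.
  - apply pow_dominated_le with (w (RtoC 0)) (M * / q0 ^ 6); auto; intros k.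
    assert (H1 := iter_Lop_le B HB B0 s Hs HW k w (fun _ => M) Hbd (bddD_const M) HMw 0 Dset_0).
    rewrite (iter_eigen B HB s HW w mu k Hbd He 0 Dset_0), Hscal in H1.
    assert (H2 := proj2 (growth k 0 Dset_0)).
    rewrite Rmult_comm; apply Rle_trans with (1 := H1); rewrite Rmult_assoc.
    apply Rmult_le_compat_l; lra.
  - apply pow_dominated_le with (d * q0 ^ 6) M; auto; [nra|intros k].
    assert (H1 := iter_Lop_le B HB B0 s Hs HW k (fun _ => d) w (bddD_const d) Hbd Hlow 0 Dset_0).
    rewrite (iter_eigen B HB s HW w mu k Hbd He 0 Dset_0), Hscal in H1.
    assert (H2 := proj1 (growth k 0 Dset_0)).
    pose proof (pow_lt mu k Hmu).
    apply Rle_trans with (d * Lpow1 B s k (RtoC 0)).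
    + rewrite Rmult_assoc; apply Rmult_le_compat_l; lra.
    + apply Rle_trans with (1 := H1); rewrite Rmult_comm; apply Rmult_le_compat_r; lra.
Qed.

Lemma lipschitz_minus_scal (u w : C -> R) t : lipschitz_onD u -> lipschitz_onD w ->
  lipschitz_onD (fun z => u z - t * w z).
Proof.
  intros [K HK] [N HN]; exists (K + Rabs t * N); intros z x Hz Hx.
  replace (u z - t * w z - (u x - t * w x)) with ((u z - u x) + (- t) * (w z - w x)) by ring.
  eapply Rle_trans; [apply Rabs_triang|]; rewrite Rabs_mult, Rabs_Ropp, Rmult_plus_distr_r.
  apply Rplus_le_compat; auto.
  rewrite Rmult_assoc; apply Rmult_le_compat_l; auto; apply Rabs_pos.
Qed.

(* Subtracting the largest multiple of v below w leaves a nonnegative eigenvector with infimum 0;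
   iter_Lop_osc as k tends to infinity bounds its values by a multiple of its infimum. *)
Lemma eigenvector_unique w mu : (forall z, Dset z -> 0 < w z) -> lipschitz_onD w ->
  (forall z, Dset z -> L w z = mu * w z) -> exists c, forall z, Dset z -> w z = c * v z.
Proof.
  intros Hw HL He; rewrite (eigenvalue_unique w mu Hw HL He) in He.
  assert (Hbw := Dlip_bdd w HL); assert (Hbv := fcone_bdd s Hs 3 v Hv).
  pose proof (pow_lt q0 3 (exp_pos _)) as Hq3.
  assert (Hvb := fun z Hz => v_bounds s Hs v Hv Hv1 z Hz).
  destruct (completeness (fun t => forall z, Dset z -> t * v z <= w z)) as [t [Ht1 Ht2]].
  { exists (w (RtoC 0)); intros t Ht; specialize (Ht _ Dset_0); rewrite Hv1 in Ht; lra. }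
  { exists 0; intros z Hz; specialize (Hw z Hz); lra. }
  set (u := fun z => w z - t * v z).
  assert (Hu0 : forall z, Dset z -> 0 <= u z).
  { intros z Hz; specialize (Hvb z Hz); unfold u.
    assert (Ht : t <= w z / v z)
      by (apply Ht2; intros r Hr; specialize (Hr z Hz); apply Rle_div_r; lra).
    apply Rle_div_r in Ht; lra. }
  assert (Hulip : lipschitz_onD u).
  { apply lipschitz_minus_scal; auto; now apply fcone_lipschitz with s 3%nat. }
  assert (Hue : forall z, Dset z -> L u z = lam * u z).
  { intros z Hz; transitivity (L (fun z => 1 * w z + (- t) * v z) z).
    - apply Lop_ext; auto; intros; unfold u; ring.
    - rewrite (Lop_comb B HB s HW), He, Hev by auto; unfold u; ring. }
  assert (Hbu := Dlip_bdd u Hulip); destruct (Dlip_dH u Hulip) as [K [HK Hud]].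
  (* Divided by lam^k, the oscillation estimate leaves an error N 2^(-k), which is made smaller than
     the supposed deficit. *)
  assert (Hosc : forall z x, Dset z -> Dset x -> q0 ^ 2 * u z <= u x).
  { intros z x Hz Hx.
    set (N := K * / q0 ^ 6).
    assert (HN : 0 <= N)
      by (apply Rmult_le_pos; auto; left; apply Rinv_0_lt_compat, pow_lt, exp_pos).
    apply Rnot_lt_le; intros Hlt.
    destruct (pow_half_small N (q0 ^ 2 * u z - u x) ltac:(lra)) as [k Hk].
    assert (H := iter_Lop_osc B HB B0 s Hs HW k u K Hu0 Hbu HK Hud z x Hz Hx).
    rewrite !(iter_eigen B HB s HW u lam k Hbu Hue) in H by auto.
    pose proof (pow_lt lam k Hl) as Hlk; pose proof (pow_lt (/ 2) k ltac:(lra)) as Hk2.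
    assert (H1 : K * (/ 2) ^ k * dH z x * Lpow1 B s k x <= lam ^ k * (N * (/ 2) ^ k)).
    { assert (G := proj2 (growth k x Hx)).
      assert (D1 := dH_le1 z x Hz Hx).
      assert (D0 := dH_ge0 z x (proj1 (Dset_re _ Hz)) (proj1 (Dset_re _ Hx))).
      assert (F := Lpow1_pos B HB B0 s Hs HW k x Hx).
      apply Rle_trans with (K * (/ 2) ^ k * 1 * (/ q0 ^ 6 * lam ^ k)).
      - apply Rmult_le_compat; try lra.
        + apply Rmult_le_pos; auto; apply Rmult_le_pos; lra.
        + apply Rmult_le_compat_l; auto; apply Rmult_le_pos; lra.
      - unfold N; right; ring. }
    assert (H2 : q0 ^ 2 * (lam ^ k * u z) <= qd s z x ^ 2 * (lam ^ k * u z)).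
    { apply Rmult_le_compat_r; [apply Rmult_le_pos; [lra|auto]|].
      apply pow_incr; split; [left; apply exp_pos|now apply qd_ge]. }
    assert (H3 : lam ^ k * (q0 ^ 2 * u z) <= lam ^ k * (u x + N * (/ 2) ^ k)) by lra.
    apply Rmult_le_reg_l in H3; auto; lra. }
  exists t; intros z Hz.
  destruct (Hu0 z Hz) as [Hpos|Hz0]; [exfalso|unfold u in Hz0; lra].
  (* If u z > 0, then u >= q0^2 u(z) on D; as v <= 1 / q0^3, the multiple t could be increased by
     q0^5 u(z), against its maximality. *)
  assert (He0 : 0 < q0 ^ 2 * u z * q0 ^ 3).
  { apply Rmult_lt_0_compat; auto; apply Rmult_lt_0_compat; auto; apply pow_lt, exp_pos. }
  enough (t + q0 ^ 2 * u z * q0 ^ 3 <= t) by lra.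
  apply Ht1; intros x Hx; specialize (Hosc z x Hz Hx); specialize (Hvb x Hx).
  unfold u in Hosc at 2.
  assert (q0 ^ 2 * u z * q0 ^ 3 * v x <= q0 ^ 2 * u z); [|lra].
  rewrite Rmult_assoc; rewrite <- (Rmult_1_r (q0 ^ 2 * u z)) at 2.
  apply Rmult_le_compat_l; [nra|].
  apply Rle_trans with (q0 ^ 3 * / q0 ^ 3); [|rewrite Rinv_r; lra].
  apply Rmult_le_compat_l; lra.
Qed.

Lemma Lop_conj u z : (forall b, B b -> B (Cconj b)) -> bddD u -> Dset z ->
  L (fun w => u (Cconj w)) z = L u (Cconj z).
Proof.
  intros Hc Hu Hz; rewrite !LopE; apply sumB_eq.
  assert (Hz' := Dset_conj z Hz).
  assert (S := sumB_spec B _ (Lop_summable B HB s HW u _ Hu Hz')).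
  apply (has_sum_involution B Cconj) in S; auto using Cconj_conj.
  revert S; apply has_sum_ext; intros b Hb.
  assert (Hn : (z + b <> 0)%C).
  { apply pos_re_neq0; apply B_re with (1 := HB) in Hb; apply Dset_re in Hz.
    destruct z, b; simpl in *; lra. }
  unfold wt, theta; rewrite <- Cplus_conj, <- Cinv_conj, Cmod_conj by auto; reflexivity.
Qed.

(** The reflected function is again a positive Lipschitz eigenvector, hence c v; the real point 0
    gives c = 1. *)
Lemma eigenvector_conj : (forall b, B b -> B (Cconj b)) ->
  forall z, Dset z -> v (Cconj z) = v z.
Proof.
  intros Hc.
  assert (Hbv := fcone_bdd s Hs 3 v Hv).
  destruct (eigenvector_unique (fun z => v (Cconj z)) lam) as [c Hcv].
  - intros z Hz; apply Dset_conj in Hz; assert (H := v_bounds s Hs v Hv Hv1 _ Hz).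
    pose proof (pow_lt q0 3 (exp_pos _)); lra.
  - destruct (fcone_lipschitz s Hs 3 v Hv) as [K HK]; exists K; intros z w Hz Hw.
    apply Dset_conj in Hz; apply Dset_conj in Hw; specialize (HK _ _ Hz Hw).
    now rewrite <- Cminus_conj, Cmod_conj in HK.
  - intros z Hz; rewrite Lop_conj, Hev by (auto; now apply Dset_conj); reflexivity.
  - intros z Hz; rewrite Hcv by auto.
    assert (H0 := Hcv _ Dset_0); replace (Cconj (RtoC 0)) with (RtoC 0) in H0.
    + rewrite Hv1 in H0; replace c with 1 by lra; ring.
    + unfold Cconj, RtoC; simpl; f_equal; ring.
Qed.

End Uniqueness.

(** * Limits of sums of translates of (X^2 + Y^2)^(-s) *)

Lemma lipschitz_of_derivative_bound (f f' : R -> R) a b M :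
  (forall x, a < x < b -> is_derive f x (f' x)) ->
  (forall x, a < x < b -> Rabs (f' x) <= M) ->
  forall x y, a < x < b -> a < y < b -> Rabs (f y - f x) <= M * Rabs (y - x).
Proof.
  intros Hd HM x y Hx Hy.
  assert (Hmm : forall c, Rmin x y <= c <= Rmax x y -> a < c < b).
  { intros c; unfold Rmin, Rmax; destruct (Rle_dec x y); lra. }
  destruct (MVT_gen f x y f') as [c [Hc ->]].
  - intros c Hc; apply Hd, Hmm; lra.
  - intros c Hc; apply derivable_continuous_pt; exists (f' c).
    now apply is_derive_Reals, Hd, Hmm.
  - rewrite Rabs_mult; apply Rmult_le_compat_r; [apply Rabs_pos|now apply HM, Hmm].
Qed.

(** Pointwise convergence of the functions suffices, because the common Lipschitz constant of the
    derivatives makes the first-order Taylor remainder quadratic uniformly in n. [Derive g x] is the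
    form in which [dx] and [dy] appear in [Ck]. *)
Lemma derivative_of_limit (f f' : nat -> R -> R) (g : R -> R) a b M :
  (forall n x, a < x < b -> is_derive (f n) x (f' n x)) ->
  (forall n x y, a < x < b -> a < y < b -> Rabs (f' n y - f' n x) <= M * Rabs (y - x)) ->
  (forall x, a < x < b -> is_lim_seq (fun n => f n x) (g x)) ->
  forall x, a < x < b ->
    is_derive g x (Derive g x) /\ is_lim_seq (fun n => f' n x) (Derive g x).
Proof.
  intros Hd HM Hg x Hx.
  assert (HM0 : 0 <= M).
  { specialize (HM O x ((x + b) / 2) Hx ltac:(lra)).
    rewrite (Rabs_pos_eq ((x + b) / 2 - x)) in HM by lra.
    pose proof (Rabs_pos (f' O ((x + b) / 2) - f' O x)).
    apply Rmult_le_reg_r with ((x + b) / 2 - x); lra. }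
  assert (T : forall n y, a < y < b ->
            Rabs (f n y - f n x - f' n x * (y - x)) <= M * Rabs (y - x) * Rabs (y - x)).
  { intros n y Hy.
    assert (Hmm : forall c, Rmin x y <= c <= Rmax x y -> a < c < b /\ Rabs (c - x) <= Rabs (y - x)).
    { intros c; unfold Rmin, Rmax; destruct (Rle_dec x y); intros Hc; split; try lra;
        unfold Rabs; destruct (Rcase_abs _), (Rcase_abs _); lra. }
    destruct (MVT_gen (f n) x y (f' n)) as [c [Hc ->]].
    - intros c Hc; apply Hd, Hmm; lra.
    - intros c Hc; apply derivable_continuous_pt; exists (f' n c).
      now apply is_derive_Reals, Hd, Hmm.
    - replace (f' n c * (y - x) - f' n x * (y - x)) with ((f' n c - f' n x) * (y - x)) by ring.
      rewrite Rabs_mult; apply Rmult_le_compat_r; [apply Rabs_pos|].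
      destruct (Hmm c Hc) as [Hc1 Hc2].
      apply Rle_trans with (1 := HM n x c Hx Hc1), Rmult_le_compat_l; auto. }
  assert (Hcau : ex_finite_lim_seq (fun n => f' n x)).
  { apply ex_lim_seq_cauchy_corr; intros eps.
    (* The step h makes each difference quotient eps/4-close to the derivative for all n at once;
       for this fixed h the quotients converge, hence are Cauchy. *)
    set (h := Rmin ((b - x) / 2) (eps / (4 * (M + 1)))).
    assert (He : 0 < eps / (4 * (M + 1))) by (apply Rdiv_lt_0_compat; [apply eps|lra]).
    assert (Hh : 0 < h) by (apply Rmin_glb_lt; lra).
    assert (Hhb : h <= (b - x) / 2) by apply Rmin_l.
    assert (Hhe : M * h <= eps / 4).
    { apply Rle_trans with ((M + 1) * (eps / (4 * (M + 1)))); [|right; field; lra].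
      apply Rmult_le_compat; try lra; apply Rmin_r. }
    assert (Hy : a < x + h < b) by lra.
    assert (Hc : ex_lim_seq_cauchy (fun n => f n (x + h) - f n x)).
    { apply ex_lim_seq_cauchy_corr; exists (g (x + h) - g x).
      apply is_lim_seq_minus'; auto. }
    destruct (Hc (mkposreal (eps * h / 4) ltac:(pose proof (cond_pos eps); nra))) as [N HN].
    exists N; intros n m Hn Hm; specialize (HN n m Hn Hm); simpl in HN.
    assert (T1 := T n _ Hy); assert (T2 := T m _ Hy).
    replace (x + h - x) with h in * by ring; rewrite (Rabs_pos_eq h) in * by lra.
    apply Rabs_le_between in T1; apply Rabs_le_between in T2; apply Rabs_def2 in HN.
    assert (M * h * h <= eps / 4 * h) by (apply Rmult_le_compat_r; lra).
    apply Rabs_def1; apply Rmult_lt_reg_r with h; auto; pose proof (cond_pos eps); nra. }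
  destruct Hcau as [l Hl].
  assert (Tg : forall y, a < y < b -> Rabs (g y - g x - l * (y - x)) <= M * Rabs (y - x) * Rabs (y - x)).
  { intros y Hy.
    apply (is_lim_seq_le (fun n => Rabs (f n y - f n x - f' n x * (y - x)))
             (fun _ => M * Rabs (y - x) * Rabs (y - x))
             (Rabs (g y - g x - l * (y - x))) (M * Rabs (y - x) * Rabs (y - x))).
    - intros n; now apply T.
    - apply (is_lim_seq_abs _ (g y - g x - l * (y - x))).
      apply is_lim_seq_minus'; [apply is_lim_seq_minus'; auto|].
      apply is_lim_seq_mult'; [exact Hl|apply is_lim_seq_const].
    - apply is_lim_seq_const. }
  assert (Hgd : is_derive g x l).
  { apply is_derive_Reals; intros eps He.
    assert (Hd0 : 0 < Rmin (Rmin ((x - a) / 2) ((b - x) / 2)) (eps / (M + 1))).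
    { repeat apply Rmin_glb_lt; try lra; apply Rdiv_lt_0_compat; lra. }
    exists (mkposreal _ Hd0); intros h Hh0 Hh; simpl in Hh.
    assert (H1 : Rabs h < (x - a) / 2)
      by (apply Rlt_le_trans with (1 := Hh); eapply Rle_trans; [apply Rmin_l|apply Rmin_l]).
    assert (H2 : Rabs h < (b - x) / 2)
      by (apply Rlt_le_trans with (1 := Hh); eapply Rle_trans; [apply Rmin_l|apply Rmin_r]).
    assert (H3 : Rabs h < eps / (M + 1))
      by (apply Rlt_le_trans with (1 := Hh); apply Rmin_r).
    assert (Hy : a < x + h < b) by (apply Rabs_def2 in H1; apply Rabs_def2 in H2; lra).
    specialize (Tg _ Hy); replace (x + h - x) with h in Tg by ring.
    replace ((g (x + h) - g x) / h - l) with ((g (x + h) - g x - l * h) * / h) by (field; auto).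
    rewrite Rabs_mult, Rabs_inv.
    assert (Hp : 0 < Rabs h) by now apply Rabs_pos_lt.
    apply Rle_lt_trans with (M * Rabs h).
    - apply Rmult_le_reg_r with (1 := Hp); rewrite Rmult_assoc, Rinv_l; lra.
    - apply Rlt_div_r in H3; nra. }
  rewrite (is_derive_unique _ _ _ Hgd); auto.
Qed.

Lemma is_derive_shift (f : R -> R) c x l :
  is_derive f (x + c) l -> is_derive (fun t => f (t + c)) x l.
Proof.
  intros H; rewrite <- (Rmult_1_l l).
  apply (is_derive_comp f (fun t => t + c) x l 1 H); auto_derive; auto.
Qed.

(* A class of functions on the right half plane which contains (X^2 + Y^2)^(-s) and is stable under
   partial derivatives: sums of c X^i Y^j (X^2 + Y^2)^t. *)
Inductive hexpr : Type :=
  | Mono (c : R) (i j : nat) (t : R)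
  | Add (e1 e2 : hexpr).

Fixpoint eval (e : hexpr) (X Y : R) : R :=
  match e with
  | Mono c i j t => c * X ^ i * Y ^ j * Rpower (X * X + Y * Y) t
  | Add e1 e2 => eval e1 X Y + eval e2 X Y
  end.

(** At i = 0 the coefficient [c * INR i] vanishes, so the convention [pred 0 = 0] is harmless. *)
Fixpoint dX (e : hexpr) : hexpr :=
  match e with
  | Mono c i j t => Add (Mono (c * INR i) (pred i) j t) (Mono (2 * c * t) (S i) j (t - 1))
  | Add e1 e2 => Add (dX e1) (dX e2)
  end.

Fixpoint dY (e : hexpr) : hexpr :=
  match e with
  | Mono c i j t => Add (Mono (c * INR j) i (pred j) t) (Mono (2 * c * t) i (S j) (t - 1))
  | Add e1 e2 => Add (dY e1) (dY e2)
  end.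

Lemma Rpower_minus_1 N t : 0 < N -> Rpower N (t - 1) = Rpower N t / N.
Proof.
  intros HN; unfold Rminus; rewrite Rpower_plus, Rpower_Ropp, Rpower_1; auto.
Qed.

Lemma eval_dX e X Y : 0 < X -> is_derive (fun x => eval e x Y) X (eval (dX e) X Y).
Proof.
  intros HX; induction e as [c i j t|e1 IH1 e2 IH2].
  - assert (HN : 0 < X * X + Y * Y) by nra.
    simpl eval; rewrite Rpower_minus_1 by auto; unfold Rpower.
    auto_derive; auto; simpl; field; lra.
  - exact (is_derive_plus _ _ _ _ _ IH1 IH2).
Qed.

Lemma eval_dY e X Y : 0 < X -> is_derive (fun y => eval e X y) Y (eval (dY e) X Y).
Proof.
  intros HX; induction e as [c i j t|e1 IH1 e2 IH2].
  - assert (HN : 0 < X * X + Y * Y) by nra.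
    simpl eval; rewrite Rpower_minus_1 by auto; unfold Rpower.
    auto_derive; auto; simpl; field; lra.
  - exact (is_derive_plus _ _ _ _ _ IH1 IH2).
Qed.

(** On this region X^2 + Y^2 lies between 1/4 and 2 r^2, so its logarithm is bounded and so is every
    real power. *)
Lemma eval_bounded e r : 1 <= r -> exists M, 0 <= M /\
  forall X Y, 1 / 2 <= X <= r -> Rabs Y <= r -> Rabs (eval e X Y) <= M.
Proof.
  intros Hr; induction e as [c i j t|e1 [M1 [P1 H1]] e2 [M2 [P2 H2]]].
  - set (K := Rabs t * (Rabs (ln (1 / 4)) + Rabs (ln (2 * r * r)))).
    exists (Rabs c * r ^ i * r ^ j * exp K); split.
    + repeat apply Rmult_le_pos; try apply Rabs_pos; try (apply pow_le; lra); left; apply exp_pos.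
    + intros X Y HX HY; simpl; rewrite !Rabs_mult, <- !RPow_abs.
      assert (HN : 1 / 4 <= X * X + Y * Y <= 2 * r * r).
      { apply Rabs_le_between in HY; split; nra. }
      assert (HX' : 0 <= Rabs X <= r) by (rewrite Rabs_pos_eq; lra).
      apply Rmult_le_compat; try apply Rabs_pos.
      * repeat apply Rmult_le_pos; try apply Rabs_pos; apply pow_le; apply Rabs_pos.
      * apply Rmult_le_compat.
        -- apply Rmult_le_pos; [apply Rabs_pos|apply pow_le, Rabs_pos].
        -- apply pow_le, Rabs_pos.
        -- apply Rmult_le_compat_l; [apply Rabs_pos|now apply pow_incr].
        -- apply pow_incr; split; [apply Rabs_pos|auto].
      * unfold Rpower; rewrite Rabs_pos_eq by (left; apply exp_pos); apply exp_le.
        apply Rle_trans with (1 := Rle_abs _); rewrite Rabs_mult; unfold K.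
        apply Rmult_le_compat_l; [apply Rabs_pos|].
        assert (L1 : ln (1 / 4) <= ln (X * X + Y * Y)) by (apply ln_le; lra).
        assert (L2 : ln (X * X + Y * Y) <= ln (2 * r * r)) by (apply ln_le; lra).
        pose proof (Rle_abs (ln (2 * r * r))); pose proof (Rabs_maj2 (ln (1 / 4))).
        pose proof (Rabs_pos (ln (2 * r * r))); pose proof (Rabs_pos (ln (1 / 4))).
        apply Rabs_le; lra.
  - exists (M1 + M2); split; [lra|]; intros X Y HX HY; simpl.
    eapply Rle_trans; [apply Rabs_triang|apply Rplus_le_compat; auto].
Qed.

Definition comb (e : hexpr) (l : list (R * C)) (z : C) : R :=
  lsum (fun ap => fst ap * eval e (fst z + fst (snd ap)) (snd z + snd (snd ap))) l.

(** A neighbourhood of D on which Re (z + p) > 1/2 whenever Re p >= 1, away from the singularity of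
    the kernel. *)
Definition box (z : C) : Prop := - (1 / 2) < fst z < 2 /\ - 2 < snd z < 2.

(** P and S will be common to all lists of a sequence, which makes the bounds on each derivative
    uniform along it. *)
Definition admissible (l : list (R * C)) (P S : R) : Prop :=
  (forall ap, In ap l -> 0 <= fst ap /\ 1 <= fst (snd ap) /\ Cmod (snd ap) <= P) /\
  lsum fst l <= S.

Lemma box_open : openC box.
Proof.
  intros [x y] [[H1 H2] [H3 H4]]; simpl in *.
  set (r := Rmin (Rmin (x + 1 / 2) (2 - x)) (Rmin (y + 2) (2 - y))).
  exists r; split.
  - unfold r; repeat apply Rmin_glb_lt; lra.
  - intros [x' y'] Hw.
    assert (Hx : Rabs (x' - x) < r).
    { apply Rle_lt_trans with (2 := Hw); eapply Rle_trans; [|apply Rmax_Cmod]; apply Rmax_l. }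
    assert (Hy : Rabs (y' - y) < r).
    { apply Rle_lt_trans with (2 := Hw); eapply Rle_trans; [|apply Rmax_Cmod]; apply Rmax_r. }
    assert (R1 : r <= x + 1 / 2) by (eapply Rle_trans; [apply Rmin_l|apply Rmin_l]).
    assert (R2 : r <= 2 - x) by (eapply Rle_trans; [apply Rmin_l|apply Rmin_r]).
    assert (R3 : r <= y + 2) by (eapply Rle_trans; [apply Rmin_r|apply Rmin_l]).
    assert (R4 : r <= 2 - y) by (eapply Rle_trans; [apply Rmin_r|apply Rmin_r]).
    apply Rabs_def2 in Hx; apply Rabs_def2 in Hy.
    unfold box; simpl; lra.
Qed.

Lemma Dset_box z : Dset z -> box z.
Proof.
  intros H; assert (Hre := Dset_re z H); apply Dset_iff in H.
  destruct z as [x y]; unfold box; simpl in *.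
  assert (y * y <= 1) by nra; repeat split; nra.
Qed.

Section Limit.
Context (ls : nat -> list (R * C)) (P S : R) (Hadm : forall n, admissible (ls n) P S).

Lemma comb_dX e n x y : box (x, y) ->
  is_derive (fun t => comb e (ls n) (t, y)) x (comb (dX e) (ls n) (x, y)).
Proof.
  intros [Hx Hy]; unfold comb; simpl in *.
  apply (lsum_derive (fun ap t => fst ap * eval e (t + fst (snd ap)) (y + snd (snd ap)))
           (fun ap t => fst ap * eval (dX e) (t + fst (snd ap)) (y + snd (snd ap)))).
  intros [a p] Hap; destruct (proj1 (Hadm n) _ Hap) as [_ [Hp _]]; simpl in *.
  apply is_derive_scal.
  apply (is_derive_shift (fun t => eval e t (y + snd p))), eval_dX; lra.
Qed.

Lemma comb_dY e n x y : box (x, y) ->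
  is_derive (fun t => comb e (ls n) (x, t)) y (comb (dY e) (ls n) (x, y)).
Proof.
  intros [Hx Hy]; unfold comb; simpl in *.
  apply (lsum_derive (fun ap t => fst ap * eval e (x + fst (snd ap)) (t + snd (snd ap)))
           (fun ap t => fst ap * eval (dY e) (x + fst (snd ap)) (t + snd (snd ap)))).
  intros [a p] Hap; destruct (proj1 (Hadm n) _ Hap) as [_ [Hp _]]; simpl in *.
  apply is_derive_scal.
  apply (is_derive_shift (fun t => eval e (x + fst p) t)), eval_dY; lra.
Qed.

Lemma comb_bounded e : exists M, 0 <= M /\ forall n z, box z -> Rabs (comb e (ls n) z) <= M.
Proof.
  destruct (eval_bounded e (Rabs P + 2)) as [M [HM H]]; [pose proof (Rabs_pos P); lra|].
  exists (M * Rabs S); split; [apply Rmult_le_pos; auto; apply Rabs_pos|].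
  intros n [x y] [Hx Hy]; simpl in Hx, Hy; unfold comb.
  apply Rle_trans with (1 := lsum_abs _ _).
  apply Rle_trans with (lsum (fun ap => M * fst ap) (ls n)).
  - apply lsum_le; intros [a p] Hap.
    destruct (proj1 (Hadm n) _ Hap) as [Ha [Hp HP]]; simpl in *.
    rewrite Rabs_mult, (Rabs_pos_eq a) by auto; rewrite Rmult_comm.
    apply Rmult_le_compat_r; auto.
    pose proof (Rmax_Cmod p); pose proof (Rmax_l (Rabs (fst p)) (Rabs (snd p))).
    pose proof (Rmax_r (Rabs (fst p)) (Rabs (snd p))).
    pose proof (Rle_abs P); pose proof (Rle_abs (fst p)).
    apply H; [lra|].
    eapply Rle_trans; [apply Rabs_triang|].
    assert (Rabs y <= 2) by (apply Rabs_le; lra). lra.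
  - rewrite lsum_scal; apply Rmult_le_compat_l; auto.
    apply Rle_trans with (1 := proj2 (Hadm n)), Rle_abs.
Qed.

Lemma comb_lipschitz e : exists M, 0 <= M /\
  (forall n x y1 y2, box (x, y1) -> box (x, y2) ->
     Rabs (comb e (ls n) (x, y2) - comb e (ls n) (x, y1)) <= M * Rabs (y2 - y1)) /\
  (forall n x1 x2 y, box (x1, y) -> box (x2, y) ->
     Rabs (comb e (ls n) (x2, y) - comb e (ls n) (x1, y)) <= M * Rabs (x2 - x1)).
Proof.
  destruct (comb_bounded (dX e)) as [M1 [P1 H1]], (comb_bounded (dY e)) as [M2 [P2 H2]].
  exists (M1 + M2); split; [lra|split].
  - intros n x y1 y2 [Hx Hy1] [_ Hy2]; simpl in *.
    apply Rle_trans with (M2 * Rabs (y2 - y1)).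
    + apply (lipschitz_of_derivative_bound (fun t => comb e (ls n) (x, t))
               (fun t => comb (dY e) (ls n) (x, t)) (-2) 2); auto.
      * intros t Ht; apply comb_dY; split; auto.
      * intros t Ht; apply H2; split; auto.
    + apply Rmult_le_compat_r; [apply Rabs_pos|lra].
  - intros n x1 x2 y [Hx1 Hy] [Hx2 _]; simpl in *.
    apply Rle_trans with (M1 * Rabs (x2 - x1)).
    + apply (lipschitz_of_derivative_bound (fun t => comb e (ls n) (t, y))
               (fun t => comb (dX e) (ls n) (t, y)) (- (1 / 2)) 2); auto.
      * intros t Ht; apply comb_dX; split; auto.
      * intros t Ht; apply H1; split; auto.
    + apply Rmult_le_compat_r; [apply Rabs_pos|lra].
Qed.

Lemma comb_limit_continuous e (F : C -> R) :
  (forall z, box z -> is_lim_seq (fun n => comb e (ls n) z) (F z)) -> continuous_onU box F.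
Proof.
  intros HF [x y] Hz eps He; destruct (comb_lipschitz e) as [M [HM [HY HX]]].
  exists (eps / (2 * M + 1)); split; [apply Rdiv_lt_0_compat; lra|].
  intros [x' y'] Hw Hd.
  assert (Dx : Rabs (x' - x) <= Cmod ((x', y') - (x, y))).
  { eapply Rle_trans; [|apply Rmax_Cmod]; apply Rmax_l. }
  assert (Dy : Rabs (y' - y) <= Cmod ((x', y') - (x, y))).
  { eapply Rle_trans; [|apply Rmax_Cmod]; apply Rmax_r. }
  set (d := Cmod ((x', y') - (x, y))) in *.
  (* A rectangle contains this corner, so the increment splits along the axes. *)
  assert (Hm : box (x', y)) by (destruct Hz, Hw; split; auto).
  assert (H : Rabs (F (x', y') - F (x, y)) <= 2 * M * d).
  { apply (is_lim_seq_le (fun n => Rabs (comb e (ls n) (x', y') - comb e (ls n) (x, y)))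
             (fun _ => 2 * M * d) (Rabs (F (x', y') - F (x, y))) (2 * M * d)).
    - intros n; specialize (HY n x' y y' Hm Hw); specialize (HX n x x' y Hz Hm).
      replace (comb e (ls n) (x', y') - comb e (ls n) (x, y)) with
        ((comb e (ls n) (x', y') - comb e (ls n) (x', y)) +
         (comb e (ls n) (x', y) - comb e (ls n) (x, y))) by ring.
      eapply Rle_trans; [apply Rabs_triang|].
      assert (M * Rabs (y' - y) <= M * d) by now apply Rmult_le_compat_l.
      assert (M * Rabs (x' - x) <= M * d) by now apply Rmult_le_compat_l.
      lra.
    - apply (is_lim_seq_abs _ (F (x', y') - F (x, y))), is_lim_seq_minus'; auto.
    - apply is_lim_seq_const. }
  apply Rle_lt_trans with (1 := H).
  assert (Hd0 : 0 <= d) by apply Cmod_ge_0.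
  apply Rlt_div_r in Hd; [nra|lra].
Qed.

(** The induction varies e and F: a partial derivative of the limit is the limit of combinations
    over the same lists, with e replaced by its derivative. *)
Lemma comb_limit_Ck k : forall e (F : C -> R),
  (forall z, box z -> is_lim_seq (fun n => comb e (ls n) z) (F z)) -> Ck k box F.
Proof.
  induction k as [|k IH]; intros e F HF; [now apply comb_limit_continuous with e|].
  assert (HX : forall z, box z ->
    is_derive (fun t => F (t, snd z)) (fst z) (dx F z) /\
    is_lim_seq (fun n => comb (dX e) (ls n) z) (dx F z)).
  { intros [x y] [Hx Hy]; destruct (comb_lipschitz (dX e)) as [M [_ [_ HL]]]; simpl in *.
    apply (derivative_of_limit (fun n t => comb e (ls n) (t, y))
             (fun n t => comb (dX e) (ls n) (t, y)) (fun t => F (t, y)) (- (1 / 2)) 2 M); auto.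
    - intros n t Ht; apply comb_dX; split; auto.
    - intros n t u Ht Hu; apply HL; split; auto.
    - intros t Ht; apply HF; split; auto. }
  assert (HY : forall z, box z ->
    is_derive (fun t => F (fst z, t)) (snd z) (dy F z) /\
    is_lim_seq (fun n => comb (dY e) (ls n) z) (dy F z)).
  { intros [x y] [Hx Hy]; destruct (comb_lipschitz (dY e)) as [M [_ [HL _]]]; simpl in *.
    apply (derivative_of_limit (fun n t => comb e (ls n) (x, t))
             (fun n t => comb (dY e) (ls n) (x, t)) (fun t => F (x, t)) (-2) 2 M); auto.
    - intros n t Ht; apply comb_dY; split; auto.
    - intros n t u Ht Hu; apply HL; split; auto.
    - intros t Ht; apply HF; split; auto. }
  simpl; split; [|split; [|split]].
  - intros z Hz; split; eexists; [apply HX|apply HY]; auto.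
  - now apply comb_limit_continuous with e.
  - apply IH with (dX e); intros z Hz; now apply HX.
  - apply IH with (dY e); intros z Hz; now apply HY.
Qed.

End Limit.

(** * Finite alphabets *)

Section Finite.
Context (B : C -> Prop) (HB : forall b, B b -> I1 b) (B0 : exists b, B b).
Context (s : R) (Hs : 0 < s).
Context (HW : forall z, Dset z -> summable B (fun b => wt s b z)).
Context (lB : list C) (HlB : NoDup lB) (HBl : forall b, B b <-> In b lB).

Local Notation L := (Lop B s).
Local Notation q0 := (exp (- (4 * s))).
Local Notation fk := (Lpow1 B s).
Local Notation hk := (Lpow1n B s).

Lemma lB_re b : In b lB -> 1 <= fst b.
Proof. intros H; now apply I1_re, HB, HBl. Qed.

Lemma Lop_finite u z : L u z = lsum (fun b => wt s b z * u (theta b z)) lB.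
Proof.
  rewrite LopE; apply sumB_eq.
  exact (has_sum_lsum B lB (fun b => wt s b z * u (theta b z)) HlB HBl).
Qed.

(** Makes combinations of translates of the kernel stable under L: p is replaced by b + 1/p, and the
    coefficient is multiplied by |p|^(-2s), which is [wt s p 0]. *)
Lemma wt_theta (b p z : C) : 0 < fst (z + b)%C -> 0 < fst p ->
  wt s b z * wt s p (theta b z) = wt s p (RtoC 0) * wt s (b + / p)%C z.
Proof.
  intros Hzb Hp.
  assert (N1 := pos_re_neq0 _ Hzb); assert (N2 := pos_re_neq0 _ Hp).
  assert (Hinv : forall u : C, 0 < fst u -> 0 < fst (/ u)%C).
  { intros u Hu; rewrite fst_inv by auto; apply Rdiv_lt_0_compat; auto.
    pose proof (Cmod_ge_re u); nra. }
  assert (N3 : (theta b z + p <> 0)%C).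
  { apply pos_re_neq0; assert (H := Hinv _ Hzb); unfold theta.
    destruct (/ (z + b))%C, p; simpl in *; lra. }
  assert (N4 : (z + (b + / p) <> 0)%C).
  { apply pos_re_neq0; assert (H := Hinv _ Hp).
    destruct (/ p)%C, z, b; simpl in *; lra. }
  assert (N5 : (0 + p <> 0)%C) by now rewrite Cplus_0_l.
  unfold wt; rewrite <- !Rinv_mult; f_equal.
  rewrite !Rpower_mult_distr by now apply Cmod_gt_0.
  rewrite <- !Cmod_mult; do 2 f_equal; unfold theta; field; auto.
Qed.

Definition kernel : hexpr := Mono 1 0 0 (- s).

Lemma eval_kernel (z p : C) : 0 < fst (z + p)%C ->
  eval kernel (fst z + fst p) (snd z + snd p) = wt s p z.
Proof.
  intros H; simpl; rewrite !Rmult_1_l.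
  change (fst z + fst p) with (fst (z + p)%C); change (snd z + snd p) with (snd (z + p)%C).
  assert (Hp := proj1 (Cmod_gt_0 _) (pos_re_neq0 _ H)).
  rewrite <- Cmod_sqr; unfold wt; rewrite <- Rpower_Ropp.
  rewrite <- Rpower_mult_distr by auto; rewrite <- Rpower_plus; f_equal; ring.
Qed.

Definition wsum (l : list (R * C)) (z : C) : R := lsum (fun ap => fst ap * wt s (snd ap) z) l.

Lemma comb_kernel l z : - 1 < fst z -> (forall ap, In ap l -> 1 <= fst (snd ap)) ->
  comb kernel l z = wsum l z.
Proof.
  intros Hz Hl; apply lsum_ext; intros ap Hap; f_equal.
  apply eval_kernel; specialize (Hl ap Hap).
  change (0 < fst z + fst (snd ap)); lra.
Qed.

Definition lift (l : list (R * C)) : list (R * C) :=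
  flat_map (fun b => map (fun ap => (fst ap * wt s (snd ap) (RtoC 0), (b + / snd ap)%C)) l) lB.

(** The list for L^(k+1) 1: it starts from L 1, whose translates are the elements of B themselves
    with coefficient 1. *)
Definition kl (k : nat) : list (R * C) := Nat.iter k lift (map (fun b => (1, b)) lB).

(** The sum dominates every |b|, and the added 1 accounts for |1/p| <= 1, so that p -> b + 1/p
    respects the bound. *)
Definition lB_bound : R := lsum Cmod lB + 1.

Lemma kl_bounds k ap : In ap (kl k) ->
  0 <= fst ap /\ 1 <= fst (snd ap) /\ Cmod (snd ap) <= lB_bound.
Proof.
  assert (Hb : forall b, In b lB -> Cmod b + 1 <= lB_bound).
  { intros b Hb; unfold lB_bound; apply Rplus_le_compat_r.
    apply in_split in Hb; destruct Hb as [l1 [l2 ->]].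
    rewrite lsum_app, lsum_cons.
    assert (P : forall l, 0 <= lsum Cmod l).
    { intros l; apply Rle_trans with (1 := Rabs_pos (lsum Cmod l)).
      eapply Rle_trans; [apply lsum_abs|]; right; apply lsum_ext; intros x _.
      apply Rabs_pos_eq, Cmod_ge_0. }
    pose proof (P l1); pose proof (P l2); lra. }
  revert ap; induction k as [|k IH]; intros ap Hap; unfold kl in Hap; simpl in Hap.
  - apply in_map_iff in Hap; destruct Hap as [b [<- Hb1]]; simpl.
    assert (H1 := Hb b Hb1); assert (H2 := lB_re b Hb1); lra.
  - apply in_flat_map in Hap; destruct Hap as [b [Hb1 Hap]].
    apply in_map_iff in Hap; destruct Hap as [[a p] [<- Hap]].
    destruct (IH _ Hap) as [Ha [Hp _]]; simpl in Ha, Hp; simpl fst; simpl snd.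
    assert (H1 := Hb b Hb1); assert (H2 := lB_re b Hb1); pose proof (Cmod_ge_re p).
    assert (Hi := Dset_re _ (Dset_inv p Hp)).
    split; [|split].
    + apply Rmult_le_pos; auto; left; apply wt_pos.
    + change (1 <= fst b + fst (/ p)%C); lra.
    + eapply Rle_trans; [apply Cmod_triangle|].
      rewrite Cmod_inv by (apply pos_re_neq0; lra).
      assert (/ Cmod p <= 1); [|lra].
      rewrite <- Rinv_1; apply Rinv_le_contravar; lra.
Qed.

(** Valid beyond D: Re z > -1 gives Re (z + b) > 0, so [theta b z] has positive real part and the
    induction continues. *)
Lemma Lpow1_kl k z : - 1 < fst z -> fk (S k) z = wsum (kl k) z.
Proof.
  revert z; induction k as [|k IH]; intros z Hz.
  - rewrite Lpow1_S, Lop_finite; unfold wsum, kl; simpl; rewrite lsum_map.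
    apply lsum_ext; intros b _; simpl; unfold Lpow1; simpl; ring.
  - change (kl (S k)) with (lift (kl k)).
    rewrite Lpow1_S, Lop_finite; unfold wsum, lift; rewrite lsum_flat_map.
    apply lsum_ext; intros b Hb; rewrite lsum_map.
    assert (Hb1 := lB_re b Hb).
    assert (Hzb : 0 < fst (z + b)%C) by (destruct z, b; simpl in *; lra).
    rewrite IH.
    + unfold wsum; rewrite <- lsum_scal; apply lsum_ext; intros [a p] Hap; simpl.
      destruct (kl_bounds k _ Hap) as [_ [Hp _]]; simpl in Hp.
      rewrite Rmult_assoc, <- wt_theta by (auto; lra); ring.
    + unfold theta; rewrite fst_inv by auto.
      apply Rlt_trans with 0; [lra|]; apply Rdiv_lt_0_compat; auto.
      pose proof (Cmod_ge_re (z + b)); nra.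
Qed.

Lemma wt_decreasing (p : C) x1 x2 y : 0 <= x1 <= x2 -> 1 <= fst p ->
  wt s p (x2, y) <= wt s p (x1, y).
Proof.
  intros Hx Hp; apply Rinv_le_contravar; [apply exp_pos|].
  apply Rle_Rpower_l; [lra|split].
  - apply Cmod_gt_0, pos_re_neq0; simpl; lra.
  - apply Rsqr_incr_0_var; [|apply Cmod_ge_0].
    unfold Rsqr; rewrite !Cmod_sqr; simpl; nra.
Qed.

(** At 0 each translate of the kernel is at least [lB_bound] to the power -2s. *)
Lemma mass_bound l : (forall ap, In ap l ->
    0 <= fst ap /\ 1 <= fst (snd ap) /\ Cmod (snd ap) <= lB_bound) ->
  lsum fst l <= Rpower lB_bound (2 * s) * wsum l (RtoC 0).
Proof.
  intros Hl; unfold wsum; rewrite <- lsum_scal; apply lsum_le; intros [a p] Hap.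
  destruct (Hl _ Hap) as [Ha [Hp HP]]; simpl in *.
  pose proof (Cmod_ge_re p) as Hc; unfold wt; rewrite Cplus_0_l.
  assert (H : Rpower (Cmod p) (2 * s) <= Rpower lB_bound (2 * s)) by (apply Rle_Rpower_l; lra).
  assert (H0 : 0 < Rpower (Cmod p) (2 * s)) by apply exp_pos.
  apply Rmult_le_reg_r with (1 := H0).
  replace (Rpower lB_bound (2 * s) * (a * / Rpower (Cmod p) (2 * s)) * Rpower (Cmod p) (2 * s))
    with (a * Rpower lB_bound (2 * s)) by (field; lra).
  now apply Rmult_le_compat_l.
Qed.

Context (v : C -> R) (lam : R) (Hl : 0 < lam) (Hv : fcone s 3 v) (Hv1 : v (RtoC 0) = 1).
Context (Hev : forall z, Dset z -> L v z = lam * v z).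
Context (Hlim : forall z, Dset z -> is_lim_seq (fun k => hk k z) (v z)).

Lemma eigenvector_decreasing x1 x2 y : Dset (x1, y) -> Dset (x2, y) -> x1 <= x2 ->
  v (x2, y) <= v (x1, y).
Proof.
  intros H1 H2 Hx.
  (* The index is shifted because [kl k] represents the iterate of order k + 1. *)
  apply (is_lim_seq_le (fun k => hk (S k) (x2, y)) (fun k => hk (S k) (x1, y))
           (v (x2, y)) (v (x1, y))).
  - intros k; pose proof (Lpow1_pos B HB B0 s Hs HW (S k) 0 Dset_0).
    assert (R1 := Dset_re _ H1); assert (R2 := Dset_re _ H2); simpl in R1, R2.
    apply Rmult_le_compat_r; [left; now apply Rinv_0_lt_compat|].
    rewrite !Lpow1_kl by (simpl; lra); apply lsum_le; intros ap Hap.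
    destruct (kl_bounds k ap Hap) as [Ha [Hp _]].
    apply Rmult_le_compat_l; auto; apply wt_decreasing; lra.
  - apply (is_lim_seq_incr_1 (fun k => hk k (x2, y))); auto.
  - apply (is_lim_seq_incr_1 (fun k => hk k (x1, y))); auto.
Qed.

(* L^2 v only involves the values of v on D as soon as Re z > -1, so lam^-2 L^2 v extends v to a
   neighbourhood of D, where it is the limit of the functions lam^-2 L^2 (hk k). *)
Lemma eigenvector_smooth : smooth_onD v.
Proof.
  set (w := fun z => / (lam * lam) * L (L v) z).
  set (c := fun k => / (lam * lam * fk k (RtoC 0))).
  (* These lists represent lam^-2 L^2 (hk k), that is, L^(k+2) 1 divided by lam^2 L^k 1 (0). *)
  set (ls := fun k => map (fun ap : R * C => (c k * fst ap, snd ap)) (kl (S k))).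
  assert (F0 : forall k, 0 < fk k (RtoC 0)) by (intros; apply Lpow1_pos; auto using Dset_0).
  assert (Hc : forall k, 0 < c k).
  { intros k; apply Rinv_0_lt_compat, Rmult_lt_0_compat; auto; nra. }
  assert (Hls : forall k ap, In ap (ls k) ->
            0 <= fst ap /\ 1 <= fst (snd ap) /\ Cmod (snd ap) <= lB_bound).
  { intros k ap Hap; apply in_map_iff in Hap; destruct Hap as [ap' [<- Hap']].
    destruct (kl_bounds _ _ Hap') as [Ha Hp]; specialize (Hc k); simpl; split; [nra|auto]. }
  assert (Hws : forall k z, - 1 < fst z -> wsum (ls k) z = c k * fk (S (S k)) z).
  { intros k z Hz; rewrite Lpow1_kl by auto; unfold wsum, ls; rewrite lsum_map, <- lsum_scal.
    apply lsum_ext; intros; simpl; ring. }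
  (* The mass is controlled by the value at 0; there both iterates are comparable to powers of lam,
     and each comparison costs 1 / q0^6. *)
  assert (Hadm : forall k, admissible (ls k) lB_bound
                    (Rpower lB_bound (2 * s) * (/ q0 ^ 6 * / q0 ^ 6))).
  { intros k; split; [apply Hls|].
    apply Rle_trans with (1 := mass_bound _ (Hls k)).
    apply Rmult_le_compat_l; [left; apply exp_pos|].
    rewrite Hws by (simpl; lra).
    assert (G1 := proj2 (Lpow1_growth B HB B0 s Hs HW v lam Hl Hv Hv1 Hev (S (S k)) 0 Dset_0)).
    assert (G2 := proj1 (Lpow1_growth B HB B0 s Hs HW v lam Hl Hv Hv1 Hev k 0 Dset_0)).
    pose proof (pow_lt q0 6 (exp_pos _)) as Hq; pose proof (Rinv_0_lt_compat _ Hq).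
    set (A := q0 ^ 6) in *.
    apply Rle_trans with (c k * (/ A * (lam * lam * lam ^ k))).
    - apply Rmult_le_compat_l; [left; auto|].
      replace (lam * lam * lam ^ k) with (lam ^ S (S k)) by (simpl; ring); exact G1.
    - unfold c; specialize (F0 k).
      apply Rmult_le_reg_l with (A * fk k (RtoC 0)); [nra|].
      replace (A * fk k (RtoC 0) * (/ (lam * lam * fk k (RtoC 0)) * (/ A * (lam * lam * lam ^ k))))
        with (lam ^ k) by (field; lra).
      replace (A * fk k (RtoC 0) * (/ A * / A)) with (fk k (RtoC 0) * / A) by (field; lra).
      apply Rmult_le_reg_r with A; auto.
      rewrite Rmult_assoc, Rinv_l by lra; lra. }
  assert (Hconv : forall z, box z -> is_lim_seq (fun k => comb kernel (ls k) z) (w z)).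
  { intros z [[Hz _] _]; unfold w; rewrite Lop_finite.
    apply is_lim_seq_ext with (fun k => / (lam * lam) * lsum (fun b => wt s b z *
      lsum (fun b' => wt s b' (theta b z) * hk k (theta b' (theta b z))) lB) lB).
    - intros k; rewrite comb_kernel; [|lra|intros ap Hap; now apply (Hls k ap)].
      rewrite Hws, !Lpow1_S, Lop_finite by lra; unfold c.
      rewrite (Rinv_mult (lam * lam)), Rmult_assoc.
      f_equal; rewrite <- lsum_scal; apply lsum_ext; intros b Hb.
      rewrite Lop_finite, <- Rmult_assoc, (Rmult_comm (/ _)), Rmult_assoc; f_equal.
      rewrite <- lsum_scal; apply lsum_ext; intros b' Hb'; unfold Lpow1n, Rdiv; ring.
    - apply (is_lim_seq_scal_l _ (/ (lam * lam)) (lsum _ _)).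
      apply lsum_lim; intros b Hb.
      apply (is_lim_seq_scal_l _ (wt s b z) (L v (theta b z))).
      rewrite Lop_finite; apply lsum_lim; intros b' Hb'.
      apply (is_lim_seq_scal_l _ (wt s b' (theta b z)) (v (theta b' (theta b z)))), Hlim.
      (* For z outside D the point [theta b z] may leave D, but its real part is positive, so the
         second map brings it back. *)
      apply theta_D; [now apply lB_re|].
      assert (Hb1 := lB_re b Hb).
      assert (Hzb : 0 < fst (z + b)%C) by (destruct z, b; simpl in *; lra).
      unfold theta; rewrite fst_inv by auto; left; apply Rdiv_lt_0_compat; auto.
      pose proof (Cmod_ge_re (z + b)); nra. }
  exists box, w; split; [apply box_open|split; [exact Dset_box|split]].
  - intros z Hz; unfold w.
    rewrite (Lop_ext B HB s (L v) (fun x => lam * v x)) by auto.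
    rewrite (Lop_scal B HB s HW), Hev by (auto; now apply fcone_bdd with s 3%nat).
    field; lra.
  - intros k; exact (comb_limit_Ck ls _ _ Hadm k kernel w Hconv).
Qed.

End Finite.

Theorem theorem4p1 :
  forall (B : C -> Prop),
    (forall b, B b -> I1 b) ->
    (exists b, B b) ->
    forall s : R, Rbar_lt (sigmaB B) (Finite s) ->
    exists (v : C -> R) (lam : R),
      0 < lam /\
      (forall z, Dset z -> 0 < v z) /\
      lipschitz_onD v /\
      (forall z, Dset z -> Lop B s v z = lam * v z) /\
      (forall (w : C -> R) (mu : R),
          (forall z, Dset z -> 0 < w z) -> lipschitz_onD w ->
          (forall z, Dset z -> Lop B s w z = mu * w z) ->
          exists c : R, forall z, Dset z -> w z = c * v z) /\
      is_lim_seq (fun k => nroot k (opnorm (Nat.iter k (Lop B s)))) lam /\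
      ((forall w, (exists b, B b /\ w = Cconj b) <-> B w) ->
          forall z, Dset z -> v (Cconj z) = v z) /\
      ((exists l : list C, forall b, B b <-> In b l) ->
          smooth_onD v /\
          forall x1 x2 y, Dset (x1, y) -> Dset (x2, y) -> x1 <= x2 ->
            v (x2, y) <= v (x1, y)).
Proof.
  intros B HB B0 s Hsig.
  destruct (summable_wt B s HB Hsig) as [Hs HW].
  destruct (eigenvector B HB B0 s Hs HW) as [v [lam [M [g [Hl [Hg [_ [Hlim [Hv [Hv1 Hev]]]]]]]]]].
  exists v, lam; split; [exact Hl|split; [|split; [|split; [exact Hev|split; [|split; [|split]]]]]].
  - intros z Hz; destruct (v_bounds s Hs v Hv Hv1 z Hz) as [H _].
    apply Rlt_le_trans with (2 := H), pow_lt, exp_pos.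
  - now apply fcone_lipschitz with s 3%nat.
  - exact (eigenvector_unique B HB B0 s Hs HW v lam Hl Hv Hv1 Hev).
  - exact (spectral_radius B HB B0 s Hs HW v lam Hl Hv Hv1 Hev).
  - intros Hc; apply (eigenvector_conj B HB B0 s Hs HW v lam Hl Hv Hv1 Hev).
    intros b Hb; apply Hc; now exists b.
  - intros [l HBl].
    (* Duplicates are removed so that the sum over the list counts each element of B once. *)
    assert (HBl' : forall b, B b <-> In b (nodup Ceq_dec l)).
    { intros b; rewrite HBl; symmetry; apply nodup_In. }
    assert (Hlim' : forall z, Dset z -> is_lim_seq (fun k => Lpow1n B s k z) (v z)).
    { intros z Hz; exact (geometric_lim _ _ _ _ Hg (fun k => Hlim k z Hz)). }
    assert (HN := NoDup_nodup Ceq_dec l).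
    split.
    + exact (eigenvector_smooth B HB B0 s Hs HW _ HN HBl' v lam Hl Hv Hv1 Hev Hlim').
    + exact (eigenvector_decreasing B HB B0 s Hs HW _ HN HBl' v Hlim').
Qed.
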